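(* The normalized volume of the base polytope of the panhandle matroid $\mathrm{Pan}_{r,s,n}$ is \[ \mathrm{Vol}(\mathcal{P}_{\mathrm{Pan}_{r,s,n}}) = \sum_{\substack{S \subseteq [n-s,n-2] \\ |S| = r-1}} \beta_n(S) = \sum_{\substack{S \subseteq [n-s,n-2] \\ |S| = r-1}} \sum_{\substack{T\subseteq S\\ T=\{t_1<\cdots<t_k\}}} (-1)^{|S\setminus T|} \binom{n-1}{t_1,\ t_2-t_1,\ \dots,\ t_k-t_{k-1},\ n-1-t_k}. \]
   Context: Let $r\leq s<n$ be nonnegative integers. The panhandle matroid $\mathrm{Pan}_{r,s,n}$ is the rank-$r$ matroid on ground set $[n]=\{1,\dots,n\}$ whose bases are the $r$-subsets $B\subseteq[n]$ with $|B\cap[s]|\geq r-1$. Its base polytope $\mathcal{P}_{\mathrm{Pan}_{r,s,n}}$ is the convex hull in $\mathbb{R}^n$ of the indicator vectors of its bases, and $\mathrm{Vol}$ denotes normalized (relative) volume, i.e. volume with respect to the lattice $\mathbb{Z}^n\cap A(P)$, where $A(P)$ is the affine span of the polytope. For $w=w_1\cdots w_{n-1}\in\mathfrak{S}_{n-1}$, its descent set is $\mathrm{Des}(w)=\{i\in[n-2]:\ w_i>w_{i+1}\}$. For $S\subseteq[n-2]$, define $\alpha_n(S)=|\{w\in\mathfrak{S}_{n-1}:\ \mathrm{Des}(w)\subseteq S\}|$ and $\beta_n(S)=|\{w\in\mathfrak{S}_{n-1}:\ \mathrm{Des}(w)=S\}|$; for $T=\{t_1<\cdots<t_k\}$ one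 has $\alpha_n(T)=\binom{n-1}{t_1,\ t_2-t_1,\ \dots,\ t_k-t_{k-1},\ n-1-t_k}$ and by inclusion–exclusion $\beta_n(S)=\sum_{T\subseteq S}(-1)^{|S\setminus T|}\alpha_n(T)$. Here $[a,b]=\{a,a+1,\dots,b\}$.
   Formalization: For r = 0 the condition |S| = r-1 is read as |S| = 0, so the sum is 1, the normalized volume of a point; read literally, the sum would be empty and the identity false. For r ≥ 1 the statement is unchanged. *)

(* Defs.v *)
From HB Require Import structures.
From mathcomp Require Import all_boot all_order all_algebra all_fingroup.
From mathcomp Require Import all_classical all_reals all_analysis.

Set Implicit Arguments.
Unset Strict Implicit.
Unset Printing Implicit Defensive.

Import Order.TTheory GRing.Theory Num.Theory.
Import numFieldNormedType.Exports.

Local Open Scope ring_scope.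

Record matroid (E : finType) := Matroid {
  bases : {set {set E}};
  bases_neq0 : bases != finset.set0;
  bases_exchange : forall A B : {set E}, A \in bases -> B \in bases ->
    forall x, x \in A :\: B ->
    exists2 y, y \in B :\: A & y |: (A :\ x) \in bases }.

(* The ground set {1, ..., n} is 'I_n, shifted by one; so [s] is
   {i : 'I_n | i < s}. *)
Definition initial_segment (s n : nat) : {set 'I_n} :=
  [set i : 'I_n | (i < s)%N]%SET.

Definition panhandle_bases (r s n : nat) : {set {set 'I_n}} :=
  [set B : {set 'I_n} |
    (#|B| == r) && (r - 1 <= #|B :&: initial_segment s n|)%N]%SET.

Lemma panhandle_bases_neq0 (r s n : nat) :
  (r <= s)%N -> (s < n)%N -> panhandle_bases r s n != finset.set0.
Proof.
move=> rs sn; apply/set0Pn; exists (initial_segment r n).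
have rn : (r <= n)%N := leq_trans rs (ltnW sn).
have card_r : #|initial_segment r n| = r.
  have -> : initial_segment r n = [set widen_ord rn i | i : 'I_r]%SET.
    apply/finset.setP => i; rewrite inE; apply/idP/imsetP => [ir|[j _ ->]].
      by exists (Ordinal ir) => //; apply: val_inj.
    by rewrite /= ltn_ord.
  rewrite card_imset ?card_ord // => i j /(congr1 val) /= ij.
  exact: val_inj.
rewrite inE card_r eqxx /=.
have /finset.setIidPl -> : initial_segment r n \subset initial_segment s n.
  by apply/fintype.subsetP => i; rewrite !inE => ir; exact: leq_trans rs.
by rewrite card_r leq_subr.
Qed.

Lemma panhandle_bases_exchange (r s n : nat) (A B : {set 'I_n}) :
  A \in panhandle_bases r s n -> B \in panhandle_bases r s n ->
  forall x, x \in A :\: B ->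
  exists2 y, y \in B :\: A & y |: (A :\ x) \in panhandle_bases r s n.
Proof.
set I := initial_segment s n.
rewrite !inE => /andP[/eqP cA sA] /andP[/eqP cB sB] x.
rewrite inE => /andP[xB xA].
have cAx : #|A :\ x|.+1 = r by rewrite -cA (cardsD1 x A) xA add1n.
have exch y : y \in B :\: A -> (r - 1 <= #|(y |: (A :\ x)) :&: I|)%N ->
    y |: (A :\ x) \in panhandle_bases r s n.
  rewrite !inE => /andP[yA _] ->; rewrite andbT cardsU1 !inE (negPf yA) andbF.
  by rewrite add1n cAx.
have [le|gt] := leqP (r - 1) #|(A :\ x) :&: I|.
  have [y yBA] : exists y, y \in B :\: A.
    apply/set0Pn; rewrite finset.setD_eq0; apply/negP => BA.
    have BAx : B \subset A :\ x by rewrite subsetD1 BA.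
    by have := fintype.subset_leq_card BAx; rewrite cB -cAx ltnn.
  exists y => //; apply: exch => //.
  by apply: leq_trans le _; apply/fintype.subset_leq_card/finset.setSI/finset.subsetUr.
have [y yBI yA] : exists2 y, y \in B :&: I & y \notin (A :\ x) :&: I.
  apply/fintype.subsetPn; apply/negP => sub.
  have := leq_trans sB (fintype.subset_leq_card sub).
  by rewrite leqNgt gt.
have [yB yI] : y \in B /\ y \in I by move: yBI; rewrite inE => /andP[].
have yx : y != x by apply: contraNneq xB => <-.
have ynA : y \notin A.
  by move: yA yI; rewrite !inE yx /= => + ys; rewrite ys andbT.
have yBA : y \in B :\: A by rewrite inE ynA.
exists y => //; apply: exch => //.
have -> : (y |: (A :\ x)) :&: I = y |: ((A :\ x) :&: I).
  rewrite finset.setIUl; congr (_ :|: _).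
  by apply/finset.setIidPl; rewrite finset.sub1set.
rewrite cardsU1 yA add1n.
have : (#|A :&: I| <= #|(A :\ x) :&: I|.+1)%N.
  rewrite finset.setIDAC (cardsD1 x (A :&: I)).
  by case: (x \in _); rewrite ?add1n ?add0n // ltnW.
exact: leq_trans sA.
Qed.

Definition panhandle (r s n : nat) (rs : (r <= s)%N) (sn : (s < n)%N) :
    matroid 'I_n :=
  Matroid (panhandle_bases_neq0 rs sn) (@panhandle_bases_exchange r s n).

Section Polytope.
Variables (R : realType) (n : nat).
Local Open Scope classical_set_scope.
Implicit Type P : set 'rV[R]_n.

Definition indicator_vec (B : {set 'I_n}) : 'rV[R]_n :=
  \row_i (i \in B)%:R.

Definition affine_span P : set 'rV[R]_n :=
  [set x | exists k (c : 'I_k -> R) (p : 'I_k -> 'rV[R]_n),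
    [/\ \sum_i c i = 1, forall i, P (p i) & x = \sum_i c i *: p i]].

Definition convex_hull P : set 'rV[R]_n :=
  [set x | exists k (c : 'I_k -> R) (p : 'I_k -> 'rV[R]_n),
    [/\ forall i, 0 <= c i, \sum_i c i = 1, forall i, P (p i)
      & x = \sum_i c i *: p i]].

Definition base_polytope (M : matroid 'I_n) : set 'rV[R]_n :=
  convex_hull [set indicator_vec B | B in [set` bases M]].

End Polytope.
Arguments base_polytope R {n} M.

(* d-dimensional Lebesgue measure of a Borel set, as the d-fold product of
   [lebesgue_measure] (compare [product_measure1]); R^0 is a point of
   measure 1. *)
Fixpoint lebesgue_rV (R : realType) (d : nat) : set 'rV[R]_d -> \bar R :=
  match d with
  | 0 => fun A => (\1_A (0 : 'rV[R]_0))%:E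
  | d'.+1 => fun A : set 'rV[R]_(1 + d') =>
      (\int[@lebesgue_measure R]_x
         lebesgue_rV [set v : 'rV[R]_d' | A (row_mx x%:M v)]%classic)%E
  end.

Section NormalizedVolume.
Variables (R : realType) (n : nat).
Local Open Scope classical_set_scope.

(* The affine map v |-> p + v *m B identifies (R^d, Z^d) with
   (A(P), Z^n /\ A(P)), where A(P) is the affine span of P. *)
Definition lattice_chart (P : set 'rV[R]_n) (d : nat)
    (p : 'rV[R]_n) (B : 'M[R]_(d, n)) : Prop :=
  [/\ row_free B,
      [set p + v *m B | v in [set: 'rV[R]_d]] = affine_span P
    & forall v : 'rV[R]_d,
        (p + v *m B \is a mxOver Num.int) = (v \is a mxOver Num.int)].

(* Volume relative to the lattice Z^n /\ A(P), normalized by d! (d being the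
   dimension of A(P)) so that a unimodular simplex has volume 1. The value does
   not depend on the chart; it is 0 by convention if there is none, that is, if
   A(P) has no lattice point. *)
Definition normalized_volume (P : set 'rV[R]_n) : \bar R :=
  xget 0%E [set vol | exists d (p : 'rV[R]_n) (B : 'M[R]_(d, n)),
    lattice_chart P p B /\
    vol = ((d`!%:R)%:E * lebesgue_rV [set v | P (p + v *m B)%R])%E].

End NormalizedVolume.

(* A permutation w_1 ... w_m is w : 'S_m with w_i = w (i - 1), while descents
   keep their 1-based values: i is a descent iff w_i > w_(i+1), i.e.
   w (i - 1) > w i. So a subset of [m - 1] is an element of {set 'I_m} that
   does not contain 0. *)
Definition Des (m : nat) (w : 'S_m) : {set 'I_m} :=
  [set i : 'I_m | [exists j : 'I_m, (j.+1 == i) && (w i < w j)%N]]%SET.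

Definition beta (n : nat) (S : {set 'I_n.-1}) : nat :=
  #|[set w : 'S_n.-1 | Des w == S]%SET|.

Definition int_interval (m a b : nat) : {set 'I_m} :=
  [set i : 'I_m | (a <= i <= b)%N]%SET.

Definition multinomial (N : nat) (ks : seq nat) : nat :=
  (N`! %/ \prod_(k <- ks) k`!)%N.

(* For T = {t_1 < ... < t_k}, the sequence
   [:: t_1; t_2 - t_1; ...; t_k - t_(k-1); m - t_k];
   [enum T] is increasing. *)
Definition gaps (m : nat) (T : {set 'I_m}) : seq nat :=
  pairmap (fun a b => b - a)%N 0%N (rcons [seq val t | t <- enum T] m).

(* Main.v *)
(* For r > 0 the polytope is cut out of the hyperplane of coordinate sum r by
   0 <= x_i <= 1 and the bound 1 on the sum of the coordinates outside [s]. Its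
   volume in an arbitrary chart is squeezed between numbers of lattice points: the
   unit cubes of the grid of step 1/k that are contained in it, and those that
   meet it, are compared with the interior lattice points of the dilations by
   k - D and k + D, D being a constant, by adding D times an interior point. No
   invariance of Lebesgue measure is needed, since lattice points are the same in
   all charts. Taking partial sums modulo k turns the interior lattice points of
   the k-th dilation into words over {0, ..., k-1} whose descent set is an
   r-1 subset of [n-s, n-2]; standardizing these words, their number is
   k^(n-1)/(n-1)! times the number of such permutations, up to lower order terms.
   The multinomial formula for the permutations with descents in T comes in the
   same way from counting words that weakly increase on each block. *)

Require Import Defs.
From mathcomp Require Import all_boot all_order all_algebra all_fingroup.
From mathcomp Require Import all_classical all_reals all_analysis.
From mathcomp Require Import zify ring lra.
Import Order.TTheory GRing.Theory Num.Theory.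
Local Open Scope ring_scope.

Set Implicit Arguments.
Unset Strict Implicit.
Unset Printing Implicit Defensive.

(** * Grid approximation of [lebesgue_rV] *)

(** The integral of a nonnegative function is a supremum over the simple functions below it, and a
    larger function has more of them. This is what makes [lebesgue_rV] monotone on arbitrary sets,
    whose slices need not have measurable volume functions. *)
Lemma ge0_le_integral_nonmeasurable (d : measure_display)
    (T : measurableType d) (R : realType) (mu : {measure set T -> \bar R})
    (f g : T -> \bar R) :
  (forall x, (0 <= f x)%E) -> (forall x, (f x <= g x)%E) ->
  (\int[mu]_x f x <= \int[mu]_x g x)%E.
Proof.
move=> f0 fg; have g0 x : (0 <= g x)%E := le_trans (f0 x) (fg x).
rewrite !ge0_integralTE//; apply: ereal_sup_le => _ [h hf <-].
by exists h => // x; exact: le_trans (hf x) (fg x).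
Qed.

Lemma lebesgue_rV_ge0 (R : realType) (d : nat) (A : set 'rV[R]_d) :
  (0 <= lebesgue_rV A)%E.
Proof.
elim: d A => [A|d IH A] /=; first by rewrite lee_fin indicE.
by apply: integral_ge0 => x _; exact: IH.
Qed.

Lemma le_lebesgue_rV (R : realType) (d : nat) (A B : set 'rV[R]_d) :
  (A `<=` B)%classic -> (lebesgue_rV A <= lebesgue_rV B)%E.
Proof.
elim: d A B => [A B AB|d IH A B AB] /=.
  rewrite lee_fin !indicE ler_nat; case: (boolP (0 \in A)) => // a0.
  by rewrite mem_set //; apply: AB; exact: set_mem.
apply: ge0_le_integral_nonmeasurable => x; first exact: lebesgue_rV_ge0.
by apply: IH => v; exact: AB.
Qed.

Lemma measurable_floor_eq (R : realType) (k : nat) (z : int) :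
  measurable [set x : R | Num.floor (k.+1%:R * x) = z]%classic /\
  lebesgue_measure [set x : R | Num.floor (k.+1%:R * x) = z]%classic
    = (k.+1%:R^-1)%:E.
Proof.
have k0 : 0 < k.+1%:R :> R by rewrite ltr0n.
have -> : [set x : R | Num.floor (k.+1%:R * x) = z]%classic
    = `[z%:~R / k.+1%:R, (z + 1)%:~R / k.+1%:R[%classic.
  apply/seteqP; split => x /=; rewrite in_itv /= ler_pdivrMr // ltr_pdivlMr //.
    by move=> <-; rewrite ![x * _]mulrC floor_itv.
  by rewrite ![x * _]mulrC => h; apply: floor_def.
split; first exact: measurable_itv.
rewrite lebesgue_measure_itv /= lte_fin ltr_pM2r ?invr_gt0 // ltr_int ltrDl ltr01.
by rewrite -EFinD -mulrBl intrD addrAC subrr add0r mul1r.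
Qed.

(** For k > 0, the union of the half-open cubes of side 1/k with lower corners f/k, f in [F]. *)
Definition grid_cubes (R : realType) (d k : nat) (F : seq 'rV[int]_d) :
  set 'rV[R]_d := [set v | map_mx (fun x => Num.floor (k%:R * x)) v \in F]%classic.

Lemma lebesgue_grid_cubes (R : realType) (d k : nat) (F : seq 'rV[int]_d) :
  uniq F ->
  lebesgue_rV (@grid_cubes R d k.+1 F) = ((size F)%:R / k.+1%:R ^+ d)%:E.
Proof.
elim: d F => [F uF|d IH F uF].
  rewrite /= indicE expr0 divr1; congr (_%:E).
  case: F uF => [_|f [|g F]]; last 1 first.
  - by rewrite /= inE (thinmx0 f) (thinmx0 g) eqxx.
  - by rewrite memNset.
  - by rewrite mem_set // /grid_cubes /= (thinmx0 f) inE; apply/eqP/thinmx0.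
rewrite /=.
transitivity (\int[@lebesgue_measure R]_x
   \sum_(f <- F) (((k.+1%:R ^+ d)^-1)%:E * (\1_[set x : R | Num.floor (k.+1%:R * x) =
      lsubmx (f : 'rV_(1 + d)) 0 0]%classic x)%:E))%E.
  apply: eq_integral => x _.
  (* The slice at first coordinate x is again a union of grid cubes, given by the tails of those f
     whose head is the floor of (k+1)x. Hence the integrand is a finite combination of indicators of
     intervals. *)
  pose G := [seq rsubmx (f : 'rV_(1 + d)) | f <- F &
     lsubmx (f : 'rV_(1 + d)) 0 0 == Num.floor (k.+1%:R * x)].
  have -> : [set v : 'rV_d | @grid_cubes R d.+1 k.+1 F (row_mx x%:M v)]%classic
      = @grid_cubes R d k.+1 G.
    have E v : map_mx (fun x => Num.floor (k.+1%:R * x)) (row_mx x%:M v)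
       = row_mx (Num.floor (k.+1%:R * x))%:M
          (map_mx (fun x => Num.floor (k.+1%:R * x)) v) :> 'rV_(1 + d).
      rewrite map_row_mx; congr row_mx; apply/rowP => j.
      by rewrite !mxE !ord1 eqxx !mulr1n.
    apply/seteqP; split => v; rewrite /grid_cubes /= E.
      move=> h; apply/mapP; exists (row_mx (Num.floor (k.+1%:R * x))%:M
          (map_mx (fun x => Num.floor (k.+1%:R * x)) v) : 'rV_(1 + d)).
        by rewrite mem_filter h andbT row_mxKl !mxE eqxx.
      by rewrite row_mxKr.
    case/mapP => f; rewrite mem_filter => /andP[/eqP <- fF] ->.
    rewrite (_ : row_mx _ _ = f) // -[RHS](hsubmxK (f : 'rV_(1 + d))).
    by congr row_mx; apply/rowP => j; rewrite !mxE !ord1 eqxx mulr1n.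
  rewrite IH; last first.
    rewrite map_inj_in_uniq ?filter_uniq // => f g.
    rewrite !mem_filter => /andP[/eqP f0 _] /andP[/eqP g0 _] fg.
    rewrite -(hsubmxK (f : 'rV_(1 + d))) -(hsubmxK (g : 'rV_(1 + d))) fg.
    by congr row_mx; apply/rowP => j; rewrite !ord1 f0 g0.
  rewrite size_map size_filter -sum1_count natr_sum mulr_suml -sumEFin.
  rewrite big_mkcond /=; apply: eq_bigr => f _.
  rewrite indicE -EFinM; case: eqP => [e|ne].
    by rewrite mem_set ?mulr1 ?mul1r.
  by rewrite memNset ?mulr0 // => e; apply: ne; rewrite e.
rewrite ge0_integral_sum //; last first.
  move=> f; apply: measurable_funeM; apply/measurable_realfun.measurable_EFinP.
  by apply: measurable_realfun.measurable_indic; have [] := measurable_floor_eq R k (lsubmx (f : 'rV_(1 + d)) 0 0).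
transitivity (\sum_(f <- F) ((k.+1%:R ^+ d.+1)^-1 : R)%:E)%E.
  apply: eq_bigr => f _.
  have [mf ef] := measurable_floor_eq R k (lsubmx (f : 'rV_(1 + d)) 0 0).
  rewrite ge0_integralZl_EFin //; last first.
    by apply/measurable_realfun.measurable_EFinP; apply: measurable_realfun.measurable_indic.
  transitivity ((k.+1%:R ^- d)%:E * (k.+1%:R^-1)%:E : \bar R)%E.
    by congr (_ * _)%E; rewrite integral_indic // setIT; exact: ef.
  by rewrite -EFinM exprS invfM mulrC.
rewrite sumEFin big_const_seq count_predT iter_addr_0.
by rewrite mulr_natl.
Qed.

(** * Descents of words and permutations *)

Definition word_Des (N : nat) (u : 'I_N -> nat) : {set 'I_N} :=
  [set i : 'I_N | [exists j : 'I_N, (j.+1 == i) && (u i < u j)%N]]%SET.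

Lemma eq_word_Des (N : nat) (u v : 'I_N -> nat) :
  (forall i j : 'I_N, j.+1 = i -> (u i < u j)%N = (v i < v j)%N) ->
  word_Des u = word_Des v.
Proof.
move=> uv; apply/finset.setP => i; rewrite !inE.
by apply: eq_existsb => j; case: eqP => //= /uv ->.
Qed.

(** Relabelling the values of a permutation by an increasing N-tuple of letters keeps its descents
    and gives an injective word; there are ['C(K, N)] such tuples. *)
Lemma card_injective_words_ge (N K : nat) (P : pred {set 'I_N}) :
  (#|[set w : 'S_N | P (Des w)]%SET| * 'C(K, N) <=
   #|[set u : {ffun 'I_N -> 'I_K} | injectiveb u && P (word_Des (val \o u))]%SET|)%N.
Proof.
rewrite -(card_ltn_sorted_tuples N K).
set W := [set w : 'S_N | _]%SET; set T := [set t : N.-tuple 'I_K | _]%SET.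
pose f (p : 'S_N * N.-tuple 'I_K) := [ffun i => tnth p.2 (p.1 i)].
have tmono (t : N.-tuple 'I_K) : t \in T ->
    {mono (fun i => val (tnth t i)) : i j / (i < j)%N >-> (i < j)%N}.
  rewrite inE => st.
  have tlt (i j : 'I_N) : (i < j)%N -> (tnth t i < tnth t j)%N.
    move=> ij; have := sorted_ltn_nth ltn_trans 0%N st.
    move=> /(_ i j); rewrite !inE size_map size_tuple => /(_ (ltn_ord i) (ltn_ord j) ij).
    by rewrite !(nth_map (tnth t i)) ?size_tuple // -!tnth_nth.
  move=> i j; apply/idP/idP; last exact: tlt.
  have := @tlt j i; case: (eqVneq i j) => [->|]; first by rewrite /= !ltnn.
  by rewrite -(inj_eq val_inj) /=; lia.
have tinj (t : N.-tuple 'I_K) : t \in T -> injective (tnth t).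
  move=> tT i j e; apply: val_inj => /=.
  by have := (tmono _ tT i j, tmono _ tT j i); rewrite e ltnn => -[]; lia.
rewrite -cardsX -(card_in_imset (f := f)).
  apply: fintype.subset_leq_card; apply/fintype.subsetP => _ /imsetP[[w t] + ->].
  rewrite inE /= inE => /andP[Pw tT]; rewrite inE; apply/andP; split.
    by apply/injectiveP => i j; rewrite !ffunE => /(tinj _ tT)/perm_inj.
  rewrite (_ : word_Des _ = Des w) //.
  by apply: eq_word_Des => i j _ /=; rewrite !ffunE tmono.
move=> [w t] [w' t']; rewrite !inE /= => /andP[_ tT] /andP[_ tT'] e.
have ei i : tnth t (w i) = tnth t' (w' i) by move/ffunP: e => /(_ i); rewrite !ffunE.
(* Both tuples are strictly increasing and have the letters of the common word as entries. *)
have tt' : t = t'.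
  apply: val_inj; apply: (inj_map val_inj).
  apply: (irr_sorted_eq ltn_trans ltnn) => //.
  apply: eq_mem_map => x; apply/tnthP/tnthP => -[i ->].
    by exists (w' ((w^-1)%g i)); rewrite -ei permKV.
  by exists (w ((w'^-1)%g i)); rewrite ei permKV.
congr pair => //; apply/permP => i.
by apply: (tinj t'); rewrite ?inE // -ei tt'.
Qed.

(* Ties are broken from left to right, so that standardization keeps the strict
   descents. *)
Section Standardization.
Variables (N : nat) (u : 'I_N -> nat).

Definition word_lt (i j : 'I_N) := (u i < u j)%N || ((u i == u j) && (i < j)%N).

Lemma word_lt_trans : transitive word_lt.
Proof. by rewrite /word_lt => j i k; lia. Qed.

(** The standardized letter at i is the rank of i, the number of positions before it in the strict
    order [word_lt]; i itself is not counted. *)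
Lemma std_subproof (i : 'I_N) : (#|[set j | word_lt j i]%SET| < N)%N.
Proof.
rewrite -[X in (_ < X)%N]card_ord; apply: proper_card.
by apply/properP; split; [exact/fintype.subsetP|exists i; rewrite // inE /word_lt; lia].
Qed.

Lemma std_fun_inj : injective (fun i => Ordinal (std_subproof i)).
Proof.
have lt i j : word_lt i j ->
    (#|[set k | word_lt k i]%SET| < #|[set k | word_lt k j]%SET|)%N.
  move=> ij; apply: proper_card; apply/properP; split.
    by apply/fintype.subsetP => k; rewrite !inE => /word_lt_trans; apply.
  by exists i; rewrite !inE // /word_lt; lia.
move=> i j /(congr1 val) /= e; apply/eqP; apply: contraT => ij.
have [/lt|/lt] : word_lt i j \/ word_lt j i.
- by move: ij; rewrite -(inj_eq val_inj) /word_lt /=; lia.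
- by rewrite e ltnn.
- by rewrite e ltnn.
Qed.

Definition std : 'S_N := perm std_fun_inj.

Lemma std_lt (i j : 'I_N) : (std i < std j)%N = word_lt i j.
Proof.
have lt k l : word_lt k l -> (std k < std l)%N.
  move=> kl; rewrite !permE /=; apply: proper_card; apply/properP; split.
    by apply/fintype.subsetP => m; rewrite !inE => /word_lt_trans; apply.
  by exists k; rewrite !inE // /word_lt; lia.
apply/idP/idP => [sij|]; last exact: lt.
have [//|[e|/lt]] : word_lt i j \/ i = j \/ word_lt j i.
- case: (eqVneq i j) => [->|]; first by right; left.
  by rewrite -(inj_eq val_inj) /word_lt /=; lia.
- by rewrite e ltnn in sij.
- by rewrite ltnNge ltnW.
Qed.

Lemma Des_std : Des std = word_Des u.
Proof. by apply: eq_word_Des => i j ij; rewrite std_lt /word_lt; lia. Qed.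

End Standardization.

(** A word is determined by its standardization, which has the same descents, and by the weakly
    increasing rearrangement of its letters; ['C(N + K, N)] counts the latter. *)
Lemma card_words_le (N K : nat) (P : pred {set 'I_N}) :
  (#|[set u : {ffun 'I_N -> 'I_K.+1} | P (word_Des (val \o u))]%SET| <=
   #|[set w : 'S_N | P (Des w)]%SET| * 'C(N + K, N))%N.
Proof.
rewrite -(card_sorted_tuples N K) -cardsX.
pose f (u : {ffun 'I_N -> 'I_K.+1}) :=
  (std (val \o u), [tuple u (((std (val \o u))^-1)%g i) | i < N]).
rewrite -(card_in_imset (f := f)).
  apply: fintype.subset_leq_card; apply/fintype.subsetP => _ /imsetP[u + ->].
  rewrite inE => Pu; rewrite !inE /= Des_std Pu /=.
  set w := std _.
  have wE (i : 'I_N) :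
      nth 0%N (map val [tuple u ((w^-1)%g k) | k < N]) i = u ((w^-1)%g i).
    by rewrite (nth_map (u ((w^-1)%g i))) ?size_tuple // -tnth_nth tnth_mktuple.
  apply/(sortedP 0%N) => i; rewrite size_map size_tuple ?card_ord => iN.
  rewrite (wE (Ordinal iN)) (wE (Ordinal (ltnW iN))).
  rewrite leqNgt; apply/negP => h.
  have : word_lt (val \o u) ((w^-1)%g (Ordinal iN)) ((w^-1)%g (Ordinal (ltnW iN))).
    by rewrite /word_lt /= h.
  by rewrite -std_lt !permKV /= ltnNge leqnSn.
move=> u v _ _ e; have ew := congr1 fst e; have et := congr1 snd e.
apply/ffunP => i; have := congr1 (fun t => tnth t (std (val \o u) i)) et.
by rewrite /= in ew; rewrite !tnth_mktuple -ew !permK.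
Qed.

(** * Descent numbers and multinomial coefficients *)

(** Comparison of leading coefficients. A Bernoulli-type estimate shows that a shift by M changes
    the power only in lower order, so that Y < X would bound (X - Y) k uniformly in k. *)
Lemma pow_squeeze (F : archiRealFieldType) (X Y : F) (N M : nat) : 0 <= X ->
  (forall k : nat, X * k%:R ^+ N <= Y * (k + M)%:R ^+ N) -> X <= Y.
Proof.
case: N => [|N] X0 XY; first by have := XY 0; rewrite !expr0 !mulr1.
have bern (x m : F) n : 0 <= x -> 0 <= m ->
    (x + m) ^+ n.+1 <= x ^+ n.+1 + n.+1%:R * m * (x + m) ^+ n.
  move=> x0 m0; elim: n => [|n IH]; first by rewrite !expr1 expr0 !mulr1 mul1r.
  have xm0 : 0 <= x + m by rewrite addr_ge0.
  have le : m * x ^+ n.+1 <= m * ((x + m) * (x + m) ^+ n).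
    by rewrite -exprS ler_wpM2l // lerXn2r ?nnegrE // lerDl.
  have := ler_wpM2l xm0 IH; rewrite -exprS => h; apply: (le_trans h).
  rewrite [x ^+ n.+2]exprS [(x + m) ^+ n.+1]exprS -[n.+2%:R]natr1.
  by move: le; set a := x ^+ n.+1; set b := (x + m) ^+ n; set c := n.+1%:R; lra.
rewrite leNgt; apply/negP => YX.
have dXY : 0 < X - Y by rewrite subr_gt0.
have key (k : nat) : (X - Y) * k%:R <= X * (N.+1%:R * M%:R).
  have [->|k0] := posnP k; first by rewrite mulr0 !mulr_ge0.
  have kM0 : 0 < (k + M)%:R :> F by rewrite ltr0n addn_gt0 k0.
  apply: (@le_trans _ _ ((X - Y) * (k + M)%:R)).
    by rewrite (ler_wpM2l (ltW dXY)) // ler_nat leq_addr.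
  rewrite -(ler_pM2r (exprn_gt0 N kM0)) -mulrA -exprS mulrBl lerBlDl.
  have /(ler_wpM2l X0) := bern k%:R M%:R N (ler0n _ _) (ler0n _ _).
  rewrite -natrD mulrDr !mulrA => h; apply: (le_trans h).
  by rewrite lerD2r.
have := truncnS_gt (X * (N.+1%:R * M%:R) / (X - Y)).
by rewrite ltr_pdivrMr // [_ * (X - Y)]mulrC => /lt_le_trans /(_ (key _)); rewrite ltxx.
Qed.

Lemma ffact_le_exp (n m : nat) : (n ^_ m <= n ^ m)%N.
Proof.
elim: m => // m IH; rewrite ffactnSr expnSr leq_mul //; exact: leq_subr.
Qed.

Lemma exp_le_ffact (n m : nat) : (n.+1 ^ m <= (m + n) ^_ m)%N.
Proof.
elim: m => // m IH; rewrite addSn ffactSS expnS leq_mul //; lia.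
Qed.

(** The blocks are chosen independently, and a weakly increasing block of length g over K + 1
    letters can be chosen in ['C(g + K, g)] ways. *)
Lemma card_sorted_blocks (K : nat) (gs : seq nat) (N : nat) : sumn gs = N ->
  #|[set t : N.-tuple 'I_K.+1 | all (sorted leq) (reshape gs (map val t))]%SET| =
  (\prod_(g <- gs) 'C(g + K, g))%N.
Proof.
move=> <- {N}; elim: gs => [|g gs IH].
  rewrite big_nil -[RHS](card_tuple 0 'I_K.+1) -cardsT.
  by apply: eq_card => t; rewrite !inE.
rewrite big_cons -IH -card_sorted_tuples -cardsX.
pose f (p : g.-tuple 'I_K.+1 * (sumn gs).-tuple 'I_K.+1) : (g + sumn gs).-tuple 'I_K.+1 :=
  cat_tuple p.1 p.2.
have finj : injective f.
  move=> [a b] [a' b'] /(congr1 val) /eqP; rewrite /= eqseq_cat ?size_tuple //.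
  by move=> /andP[/eqP/val_inj -> /eqP/val_inj ->].
have fE p : all (sorted leq) (reshape (g :: gs) (map val (f p))) =
    (sorted leq (map val p.1) && all (sorted leq) (reshape gs (map val p.2))).
  by rewrite /= map_cat take_size_cat ?drop_size_cat ?size_map ?size_tuple.
rewrite -(card_imset _ finj); apply: eq_card => t; apply/idP/imsetP.
  pose a := [tuple tnth t (lshift _ i) | i < g].
  pose b := [tuple tnth t (rshift g i) | i < sumn gs].
  have -> : t = f (a, b).
    apply: eq_from_tnth => i; case: (fintype.splitP i) => j e.
      by rewrite (_ : i = lshift _ j) ?tnth_lshift ?tnth_mktuple //; exact: val_inj.
    by rewrite (_ : i = rshift _ j) ?tnth_rshift ?tnth_mktuple //; exact: val_inj.
  by rewrite inE fE => h; exists (a, b) => //; rewrite !inE.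
by case=> p + ->; rewrite inE fE !inE.
Qed.

Lemma sumn_gaps (a m : nat) (ts : seq nat) : path leq a ts -> (last a ts <= m)%N ->
  sumn (pairmap (fun a b => b - a)%N a (rcons ts m)) = (m - a)%N.
Proof.
elim: ts a => [|t ts IH] a /=; first by rewrite addn0.
move=> /andP[at_ pts] lm; rewrite IH //.
have : (t <= last t ts)%N.
  have := order_path_min leq_trans pts => /allP h.
  by case: (ts) h lm => //= x s h _; apply: h; rewrite mem_last.
lia.
Qed.

(** Here [a] is the cut at which [s] starts, which lets the induction peel off one block at a time.
    The comparison of entries i and i+1 is waived exactly when a cut separates them. *)
Lemma sorted_reshape_gaps (a m : nat) (ts s : seq nat) :
  path leq a ts -> (last a ts <= m)%N -> size s = (m - a)%N ->
  all (sorted leq) (reshape (pairmap (fun a b => b - a)%N a (rcons ts m)) s) <->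
  (forall i, (i.+1 < size s)%N -> (a + i.+1)%N \notin ts ->
     (nth 0 s i <= nth 0 s i.+1)%N).
Proof.
elim: ts a s => [|t ts IH] a s /=.
  move=> _ am ss; rewrite -ss take_size andbT; split.
    by move/(sortedP 0%N) => h i + _; exact: h.
  by move=> h; apply/(sortedP 0%N) => i /h; apply.
move=> /andP[at_ pts] lm ss.
have /allP tmin := order_path_min leq_trans pts.
have tl : (t <= last t ts)%N.
  by case: (ts) tmin => //= x s' h; apply: h; rewrite mem_last.
have tm := leq_trans tl lm.
have sd : size (drop (t - a) s) = (m - t)%N by rewrite size_drop ss; lia.
have st : size (take (t - a) s) = (t - a)%N by rewrite size_take ss; case: ltnP; lia.
split.
  move=> /andP[/(sortedP 0%N) h1 /(IH _ _ pts lm sd) h2] i is_; rewrite inE negb_or.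
  move=> /andP[ait aits]; have [lt|ge] := ltnP i.+1 (t - a).
    by have := h1 i; rewrite st !nth_take //; [apply|lia].
  have e : i = (t - a + (i - (t - a)))%N by lia.
  have e' : i.+1 = (t - a + (i - (t - a)).+1)%N by lia.
  rewrite {1}e e' -!nth_drop; apply: h2; first by rewrite sd; lia.
  by rewrite (_ : _ + _ = a + i.+1)%N //; lia.
move=> h; apply/andP; split.
  apply/(sortedP 0%N) => i; rewrite st => it.
  rewrite !nth_take //; last by lia.
  apply: h; first by lia.
  rewrite inE negb_or; apply/andP; split; first by lia.
  by apply/negP => /tmin; lia.
apply/(IH _ _ pts lm sd) => i; rewrite sd => im nin.
rewrite !nth_drop addnS; apply: h; first by lia.
rewrite inE negb_or (_ : _ + _ = t + i.+1)%N ?nin ?andbT; lia.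
Qed.

Section Alpha.
Variables (N : nat) (T : {set 'I_N}).

Let ts := [seq val t | t <- enum T].

Let path_ts : path leq 0%N ts.
Proof.
suff : sorted leq ts by case: (ts).
apply: (@subseq_sorted _ leq leq_trans _ (iota 0 N)); last exact: iota_sorted.
by rewrite -val_enum_ord; apply: map_subseq; rewrite {1}/enum_mem -enumT filter_subseq.
Qed.

Let last_ts : (last 0%N ts <= N)%N.
Proof.
have : last 0%N ts \in 0%N :: ts by exact: mem_last.
by rewrite inE => /orP[/eqP -> //|/mapP[i _ ->]]; exact: ltnW (ltn_ord i).
Qed.

Let sum_gaps : sumn (gaps T) = N.
Proof. by rewrite /gaps sumn_gaps ?subn0. Qed.

Lemma card_words_Des_sub (K : nat) :
  #|[set u : {ffun 'I_N -> 'I_K.+1} | word_Des (val \o u) \subset T]%SET| =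
  (\prod_(g <- gaps T) 'C(g + K, g))%N.
Proof.
rewrite -(card_sorted_blocks K sum_gaps).
pose f (u : {ffun 'I_N -> 'I_K.+1}) := [tuple u i | i < N].
have finj : injective f.
  move=> u v e; apply/ffunP => i; have := congr1 (fun t => tnth t i) e.
  by rewrite !tnth_mktuple.
have fP u : all (sorted leq) (reshape (gaps T) (map val (f u))) =
    (word_Des (val \o u) \subset T).
  have sf : size (map val (f u)) = (N - 0)%N by rewrite size_map size_tuple subn0.
  have nf (i : 'I_N) : nth 0%N (map val (f u)) i = u i.
    by rewrite (nth_map (u i)) ?size_tuple // -tnth_nth tnth_mktuple.
  have [reshapeP Preshape] := sorted_reshape_gaps path_ts last_ts sf.
  apply/idP/fintype.subsetP => [/reshapeP h|h].
    move=> i; rewrite inE => /existsP[j /andP[/eqP ji ltij]].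
    apply: contraTT ltij => iT; rewrite -leqNgt /= -!nf -ji; apply: h.
      by rewrite sf subn0 ji.
    by rewrite add0n ji (mem_map val_inj) mem_enum.
  apply: Preshape => i; rewrite sf subn0 add0n => iN iT.
  rewrite leqNgt; apply/negP => lt; move: iT => /negP; apply.
  rewrite -[i.+1]/(val (Ordinal iN)) (mem_map val_inj) mem_enum; apply: h.
  rewrite inE; apply/existsP; exists (Ordinal (ltnW iN)); rewrite /= eqxx /=.
  by rewrite -(nf (Ordinal iN)) -(nf (Ordinal (ltnW iN))).
rewrite -(card_imset _ finj); apply: eq_card => t; apply/imsetP/idP.
  by case=> u + ->; rewrite !inE fP.
rewrite inE => ht; have et : t = f [ffun i => tnth t i].
  by apply: eq_from_tnth => i; rewrite tnth_mktuple ffunE.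
by exists [ffun i => tnth t i] => //; rewrite inE -fP -et.
Qed.

(* Both K^N alpha(T) / N! and K^N / prod g! are the leading terms of the number
   of words over K + 1 letters with descents in T. *)
Lemma card_perm_Des_sub :
  #|[set w : 'S_N | Des w \subset T]%SET| = multinomial N (gaps T).
Proof.
set alpha := #|_|; set gs := gaps T.
pose G := (\prod_(g <- gs) g`!)%N.
have G0 : (0 < G)%N by rewrite prodn_gt0 // => g; exact: fact_gt0.
pose P K := (\prod_(g <- gs) (g + K) ^_ g)%N.
(* Clearing the denominators of the word count turns it into a product of falling factorials, which
   lies between K^N and (K + N)^N. *)
have PE K : (P K = G * \prod_(g <- gs) 'C(g + K, g))%N.
  by rewrite /G -big_split; apply: eq_bigr => g _ /=; rewrite mulnC bin_ffact.
have expN k : (\prod_(g <- gs) k ^ g = k ^ N)%N.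
  by rewrite -sum_gaps -/gs sumnE (big_morph _ (expnD k) (expn0 k)).
have lo K : (K ^ N <= P K)%N.
  rewrite -expN; apply: leq_prod => g _; apply: leq_trans (exp_le_ffact _ _).
  by case: g => // g; rewrite leq_exp2r.
have hi K : (P K <= (K + N) ^ N)%N.
  rewrite -expN /P !big_seq; apply: leq_prod => g gin.
  apply: leq_trans (ffact_le_exp _ _) _; case: (posnP g) => [->//|g0].
  rewrite leq_exp2r // addnC leq_add2l -sum_gaps sumnE -/gs.
  by rewrite (big_rem g gin) /= leq_addr.
have h1 K : (alpha * 'C(K.+1, N) <= \prod_(g <- gs) 'C(g + K, g))%N.
  rewrite -card_words_Des_sub.
  apply: (leq_trans (card_injective_words_ge _ (fun S => S \subset T))).
  by apply: fintype.subset_leq_card; apply/fintype.subsetP => u; rewrite !inE => /andP[].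
have h2 K : (\prod_(g <- gs) 'C(g + K, g) <= alpha * 'C(N + K, N))%N.
  by rewrite -card_words_Des_sub; exact: (card_words_le _ (fun S => S \subset T)).
suff e : (alpha * G = N`!)%N by rewrite /multinomial -/gs -/G -e mulnK.
apply/eqP; rewrite eqn_leq -!(ler_nat rat); apply/andP; split.
  apply: (@pow_squeeze _ _ _ N (N + N)) => // k.
  rewrite -!natrX -!natrM ler_nat.
  apply: (@leq_trans (alpha * G * (k + N).+1 ^_ N)).
    rewrite leq_mul2l; apply/orP; right; have := exp_le_ffact k.+1 N.
    rewrite addnS [(N + k)%N]addnC; apply: leq_trans.
    have [->|N0] := posnP N; first by rewrite !expn0.
    by rewrite leq_exp2r //; lia.
  rewrite addnA; apply: leq_trans (leq_mul (leqnn _) (hi _)).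
  rewrite PE -bin_ffact; have := leq_mul (leqnn (N`! * G)) (h1 (k + N)%N).
  by congr (_ <= _)%N; ring.
apply: (@pow_squeeze _ _ _ N N) => // k.
rewrite -!natrX -!natrM ler_nat.
apply: (@leq_trans (N`! * P k)); first by rewrite leq_mul2l lo orbT.
apply: (@leq_trans (alpha * G * (N + k) ^_ N)); last first.
  by rewrite leq_mul2l addnC ffact_le_exp orbT.
rewrite PE -bin_ffact; have := leq_mul (leqnn (N`! * G)) (h2 k).
by congr (_ <= _)%N; ring.
Qed.

End Alpha.

Lemma sum_signed_interval (R : comNzRingType) (I : finType) (D S : {set I}) :
  \sum_(T : {set I} | T \subset S) (-1) ^+ #|S :\: T| * (D \subset T)%:R
  = (D == S)%:R :> R.
Proof.
(* The sum is an expanded product over i: [F i] is the factor when i is in T, [G i] the factor when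
   it is not. Their sum is 0 exactly when i lies in one of D and S but not in the other, and 1
   otherwise. *)
pose F (i : I) : R := (i \in S)%:R.
pose G (i : I) : R := if i \in D then 0 else if i \in S then -1 else 1.
transitivity (\prod_i (F i + G i)).
  rewrite bigA_distr big_mkcond; apply: eq_bigr => T _.
  have [TS|/fintype.subsetPn[i iT iS]] := boolP (T \subset S); last first.
    by rewrite (bigD1 i) //= iT /F (negPf iS) mul0r.
  have [DT|/fintype.subsetPn[i iD iT]] := boolP (D \subset T); last first.
    by rewrite (bigD1 i) //= (negPf iT) /G iD mul0r mulr0.
  rewrite mulr1 -prodr_const big_mkcond; apply: eq_bigr => i _.
  rewrite inE /F /G; case: (boolP (i \in T)) => iT /=.
    by rewrite (fintype.subsetP TS).
  by case: (boolP (i \in D)) => // /(fintype.subsetP DT); rewrite (negPf iT).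
rewrite {}/F {}/G; have [->|DS] := eqVneq D S.
  by rewrite big1 // => i _; case: (i \in S); rewrite ?addr0 ?add0r.
have [i] : exists i, (i \in D) != (i \in S).
  apply/existsP; apply: contraNT DS; rewrite negb_exists => /forallP h.
  by apply/eqP/finset.setP => i; have := h i; rewrite negbK => /eqP.
rewrite (bigD1 i) //=.
by case: (i \in D); case: (i \in S) => // _; rewrite ?addr0 ?subrr mul0r.
Qed.

Lemma beta_inclusion_exclusion (R : comNzRingType) (n : nat) (S : {set 'I_n.-1}) :
  (beta S)%:R = \sum_(T : {set 'I_n.-1} | T \subset S)
    (-1) ^+ #|S :\: T| * (multinomial n.-1 (gaps T))%:R :> R.
Proof.
have cardE (P : pred 'S_n.-1) : #|[set w | P w]%SET|%:R = \sum_w (P w)%:R :> R.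
  rewrite -sum1dep_card natr_sum big_mkcond.
  by apply: eq_bigr => w _; case: (P w).
under eq_bigr => T _ do rewrite -card_perm_Des_sub cardE mulr_sumr.
rewrite exchange_big /= cardE.
by apply: eq_bigr => w _; rewrite sum_signed_interval.
Qed.

(** * Lattice points and descents *)

(** A step smaller than k crosses at most one multiple of k, and it crosses one exactly when the
    remainder drops. *)
Lemma divn_add_lt (k x b : nat) : (b < k)%N ->
  ((x + b) %/ k = x %/ k + ((x + b) %% k < x %% k))%N.
Proof.
move=> bk; have k0 : (0 < k)%N by lia.
have xk := ltn_pmod x k0.
rewrite {1 3}(divn_eq x k) -addnA divnMDl // modnMDl; congr (_ + _)%N.
move: (x %% k)%N xk => y yk; have [lt|ge] := ltnP (y + b) k.
  by rewrite divn_small // modn_small //; lia.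
have e : (y + b = 1 * k + (y + b - k))%N by lia.
have ybk : (y + b - k < k)%N by lia.
by rewrite e divnMDl // modnMDl divn_small ?modn_small //; lia.
Qed.

Lemma sum_divn (k : nat) (b : nat -> nat) (m : nat) :
  (0 < k)%N -> (forall j, (j < m)%N -> (b j < k)%N) ->
  ((\sum_(j < m) b j) %/ k = \sum_(i < m)
     ((\sum_(j < i.+1) b j) %% k < (\sum_(j < i) b j) %% k))%N.
Proof.
move=> k0; elim: m => [|m IH] bk; first by rewrite !big_ord0 div0n.
rewrite [RHS]big_ord_recr /= -IH; last by move=> j jm; apply: bk; lia.
have -> : (\sum_(j < m.+1) b j = \sum_(j < m) b j + b m)%N by rewrite big_ord_recr.
by rewrite divn_add_lt // bk.
Qed.

Lemma mem_word_Des (N : nat) (c : nat -> nat) (i : 'I_N) : c 0%N = 0%N ->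
  (i \in word_Des (fun i : 'I_N => c i.+1)) = (c i.+1 < c i)%N.
Proof.
move=> c0; rewrite inE; apply/existsP/idP => [[j /andP[/eqP <-]] //|h].
case: i h => -[|i] iN; rewrite /= ?c0 // => h.
by exists (Ordinal (ltnW iN)); rewrite /= eqxx.
Qed.

Lemma card_word_Des (N : nat) (c : nat -> nat) : c 0%N = 0%N ->
  #|word_Des (fun i : 'I_N => c i.+1)| = (\sum_(i < N) (c i.+1 < c i))%N.
Proof.
move=> c0; rewrite -sum1_card big_mkcond; apply: eq_bigr => i _.
by rewrite mem_word_Des //; case: ltnP.
Qed.

Section LatticePoints.
Variables (r s N : nat).
Hypotheses (r_gt0 : (0 < r)%N) (rs : (r <= s)%N) (sN : (s <= N)%N).

(** The index sets of the theorem for n = N + 1, in a form convertible to its summation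
    condition. *)
Definition panhandle_descents (S : {set 'I_N}) :=
  (S \subset int_interval N (N.+1 - s) (N.+1 - 2)) && (#|S| == r - 1)%N.

(* The coordinates are reversed (see [lattice_row]), so that the partial sums
   start in the part outside [s], where they cannot reach k. *)
Definition reversed_lattice_points (k : nat) : {set {ffun 'I_N.+1 -> 'I_k}} :=
  [set a : {ffun 'I_N.+1 -> 'I_k} |
    [&& [forall i, 0 < a i], \sum_i a i == r * k
      & \sum_(i < N.+1 | i < N.+1 - s) a i < k]%N]%SET.

Let b (k : nat) (a : {ffun 'I_N.+1 -> 'I_k}) (j : nat) : nat := a (inord j).
Let U (k : nat) (a : {ffun 'I_N.+1 -> 'I_k}) (m : nat) := (\sum_(j < m) b a j)%N.

Let sum_lt k (a : {ffun 'I_N.+1 -> 'I_k}) m : (m <= N.+1)%N ->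
  (\sum_(i < N.+1 | i < m) a i = U a m)%N.
Proof.
move=> mN; rewrite /U (big_ord_widen N.+1 (b a) mN).
by apply: eq_bigr => i _; rewrite /b inord_val.
Qed.

Let sum_all k (a : {ffun 'I_N.+1 -> 'I_k}) : (\sum_i a i = U a N.+1)%N.
Proof.
by rewrite -sum_lt //; apply: eq_bigl => i; rewrite ltn_ord.
Qed.

Let U_le k (a : {ffun 'I_N.+1 -> 'I_k}) m m' : (m <= m')%N -> (U a m <= U a m')%N.
Proof.
move=> mm; rewrite /U (big_ord_widen m' (b a) mm) big_mkcond.
by apply: leq_sum => i _; case: ifP.
Qed.

Let UE k (a : {ffun 'I_N.+1 -> 'I_k}) m : U a m.+1 = (U a m + b a m)%N.
Proof. by rewrite /U big_ord_recr. Qed.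

(* A lattice point goes to the word of its partial sums modulo k: each step is
   less than k, so its descents are the passages beyond a multiple of k. *)
Lemma lattice_points_le (K : nat) :
  (#|reversed_lattice_points K.+1| <=
   #|[set w : 'S_N | panhandle_descents (Des w)]%SET| * 'C(N + K, N))%N.
Proof.
apply: leq_trans (card_words_le _ _).
pose f (a : {ffun 'I_N.+1 -> 'I_K.+1}) : {ffun 'I_N -> 'I_K.+1} :=
  [ffun i : 'I_N => inord (U a i.+1 %% K.+1)].
have fE a i : f a i = (U a i.+1 %% K.+1)%N :> nat.
  by rewrite ffunE inordK // ltn_pmod.
rewrite -(card_in_imset (f := f)).
  apply: fintype.subset_leq_card; apply/fintype.subsetP => _ /imsetP[a + ->].
  rewrite !inE => /and3P[/forallP a0 /eqP]; rewrite sum_all sum_lt ?leq_subr // => sa ta.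
  pose c m := (U a m %% K.+1)%N.
  have c0 : c 0%N = 0%N by rewrite /c /U big_ord0 mod0n.
  have -> : word_Des (val \o f a) = word_Des (fun i : 'I_N => c i.+1).
    by apply: eq_word_Des => i j _ /=; rewrite !fE.
  apply/andP; split.
    apply/fintype.subsetP => i; rewrite mem_word_Des // inE => ci.
    apply/andP; split; last by have := ltn_ord i; lia.
    rewrite leqNgt; apply/negP => il; move: ci; rewrite /c.
    (* Up to index n - s the partial sums stay below K + 1, so reducing them changes nothing and
       they cannot descend. *)
    have h1 : (U a i.+1 <= U a (N.+1 - s))%N by apply: U_le.
    have h2 := U_le a (leqnSn i).
    by rewrite !modn_small //; lia.
  rewrite card_word_Des // -sum_divn //; last by move=> j _; exact: ltn_ord.
  rewrite -/(U a N); have := a0 (inord N); have := ltn_ord (a (inord N)).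
  rewrite -/(b a N); have := UE a N; rewrite sa => e b1 b2.
  (* The total is r(K+1) and the last coordinate lies strictly between 0 and K+1, so exactly r - 1
     multiples are passed before the last step. *)
  have -> : U a N = ((r - 1) * K.+1 + (K.+1 - b a N))%N by rewrite mulnBl; nia.
  by rewrite divnMDl // divn_small ?addn0 //; lia.
move=> a a'; rewrite !inE => /and3P[_ /eqP + _] /and3P[_ /eqP + _].
rewrite !sum_all => sa sa' e; apply/ffunP => i; apply: val_inj.
have Um m : (m <= N.+1)%N -> U a m = U a' m %[mod K.+1].
  case: m => [|m]; first by rewrite /U !big_ord0.
  rewrite leq_eqVlt => /orP[/eqP[->]|]; first by rewrite sa sa'.
  rewrite ltnS => mN; have := congr1 (fun u : {ffun _ -> _} => val (u (Ordinal mN))) e.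
  by rewrite /= !fE.
have := Um i.+1 (ltn_ord i); rewrite !UE => /eqP.
rewrite -modnDml (Um i (ltnW (ltn_ord i))) modnDml eqn_modDl.
by rewrite /b inord_val !modn_small ?ltn_ord // => /eqP.
Qed.

(* Conversely a word yields its cyclic differences modulo k, starting from and
   returning to 0; injectivity and positivity make them nonzero. *)
Lemma lattice_points_ge (K : nat) :
  (#|[set w : 'S_N | panhandle_descents (Des w)]%SET| * 'C(K, N) <=
   #|reversed_lattice_points K.+1|)%N.
Proof.
apply: leq_trans (card_injective_words_ge _ _) _.
(* The word with letters raised by one, hence nonzero, and framed by 0 at indices 0 and N + 1. *)
pose g (u : {ffun 'I_N -> 'I_K}) (m : nat) : nat :=
  if m is i.+1 then oapp (fun j => (u j).+1) 0%N (insub i) else 0%N.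
have gS u (i : 'I_N) : g u i.+1 = (u i).+1 by rewrite /g valK.
have gO u i (iN : (i < N)%N) : g u i.+1 = (u (Ordinal iN)).+1.
  exact: gS u (Ordinal iN).
have gN u : g u N.+1 = 0%N by rewrite /g insubN // ltnn.
have glt u m : (g u m < K.+1)%N.
  by case: m => //= m; case: insub => //= j; rewrite ltnS ltn_ord.
pose f (u : {ffun 'I_N -> 'I_K}) : {ffun 'I_N.+1 -> 'I_K.+1} :=
  [ffun i : 'I_N.+1 => inord ((g u i.+1 + (K.+1 - g u i)) %% K.+1)].
have bE u m : (m <= N)%N -> b (f u) m = ((g u m.+1 + (K.+1 - g u m)) %% K.+1)%N.
  by move=> mN; rewrite /b ffunE inordK ?ltn_pmod // inordK.
(* The differences telescope modulo K + 1. *)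
have Ug u m : (m <= N.+1)%N -> (U (f u) m %% K.+1 = g u m)%N.
  elim: m => [|m IH] mN; first by rewrite /U big_ord0 mod0n.
  rewrite UE bE // modnDmr -modnDml IH; last exact: ltnW.
  have := glt u m; rewrite addnCA subnKC ?modnDr => [gm|]; last by have := glt u m; lia.
  by rewrite modn_small.
rewrite -(card_in_imset (f := f)).
  apply: fintype.subset_leq_card; apply/fintype.subsetP => _ /imsetP[u + ->].
  rewrite !inE => /andP[/injectiveP uinj /andP[sub card]].
  have DE : word_Des (val \o u) = word_Des (fun i : 'I_N => g u i.+1).
    apply: eq_word_Des => i j _.
    by transitivity ((u i).+1 < (u j).+1)%N; rewrite // -!gS.
  have Udiv m : (m <= N.+1)%N ->
      (U (f u) m %/ K.+1 = \sum_(i < m) (g u i.+1 < g u i))%N.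
    move=> mN; rewrite /U sum_divn //; last by move=> j _; exact: ltn_ord.
    by apply: eq_bigr => i _; rewrite -!/(U _ _) !Ug //; have := ltn_ord i; lia.
  have gNpos : (0 < g u N)%N.
    have N0 : (0 < N)%N by lia.
    have pN : (N.-1 < N)%N by lia.
    by have := gO u _ pN; rewrite prednK // => ->.
  rewrite sum_all sum_lt ?leq_subr //; apply/and3P; split.
  (* A zero coordinate means two equal neighbours in [g u]. At the two ends this contradicts
     positivity of the letters, in between it contradicts injectivity. *)
  - apply/forallP => i; rewrite lt0n; apply/eqP => fi0.
    have : b (f u) i = 0%N by rewrite /b inord_val.
    have iN : (i <= N)%N by have := ltn_ord i; lia.
    rewrite bE // => /eqP; rewrite -/(_ %| _)%N => dv.
    have ge : g u i.+1 = g u i.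
      have g1 := glt u i; have g2 := glt u i.+1.
      have [] : (g u i.+1 + (K.+1 - g u i) = 0)%N \/
         (g u i.+1 + (K.+1 - g u i) = K.+1)%N; try lia.
      move: dv => /dvdnP[q]; case: q => [|[|q]]; rewrite ?mul0n ?mul1n; [by left|by right|].
      by rewrite !mulSn; lia.
    move: (nat_of_ord i) iN ge {fi0 dv} => {i} -[|i] iN ge.
      have N0 : (0 < N)%N by lia.
      by have := gO u _ N0; rewrite ge.
    move: ge; have [eN|ltN] := eqVneq i.+1 N.
      by rewrite eN gN => e; rewrite -e in gNpos.
    have iN' : (i.+1 < N)%N by rewrite ltn_neqAle ltN.
    rewrite (gO _ _ iN') (gO _ _ (ltnW iN')).
    by case=> /val_inj/uinj/(congr1 val)/=; lia.
  - rewrite (divn_eq (U _ _) K.+1) Ug // gN addn0 Udiv //.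
    (* The final return to 0 is one more descent, which raises the r - 1 descents of the word to the
       required quotient r. *)
    have last_desc : (g u N.+1 < g u N)%N = true by rewrite gN.
    rewrite big_ord_recr (congr1 nat_of_bool last_desc).
    have e : (\sum_(i < N) (g u i.+1 < g u i) + 1 = r)%N.
      by rewrite -card_word_Des // -DE (eqP card); lia.
    exact/eqP/(congr1 (muln^~ K.+1) e).
  - rewrite (divn_eq (U _ _) K.+1) Ug ?leq_subr // Udiv ?leq_subr // big1 ?add0n ?glt //.
    (* No descent occurs before position n - s, so the sum of the first n - s coordinates has
       quotient 0, that is, stays below K + 1. *)
    move=> i _; apply/eqP; rewrite eqb0; apply/negP => lt.
    have iN : (i < N)%N by have := ltn_ord i; lia.
    have : Ordinal iN \in word_Des (val \o u) by rewrite DE mem_word_Des.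
    by move=> /(fintype.subsetP sub); rewrite inE /=; have := ltn_ord i; lia.
move=> u u' _ _ e; apply/ffunP => i; apply: val_inj.
have := Ug u i.+1 (leqW (ltn_ord i)).
by rewrite e Ug ?gS ?ltnS // 1?ltnW // => -[].
Qed.

End LatticePoints.

(** * Inequalities for the panhandle polytope *)

Section PanhandlePolytope.
Variables (R : realType) (r s n : nat).
Hypotheses (rs : (r <= s)%N) (sn : (s < n)%N).

Local Notation polytope := (base_polytope R (panhandle rs sn)).

Definition panhandle_ineqs (x : 'rV[R]_n) : Prop :=
  [/\ forall i, 0 <= x 0 i <= 1, \sum_i x 0 i = r%:R
    & \sum_(i < n | (s <= i)%N) x 0 i <= 1].

Lemma panhandle_ineqs_basis (B : {set 'I_n}) :
  (B \in panhandle_bases r s n) <-> panhandle_ineqs (indicator_vec R B).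
Proof.
have sumB (P : pred 'I_n) :
    \sum_(i | P i) indicator_vec R B 0 i = #|[set i in B | P i]%SET|%:R.
  rewrite -sum1_card natr_sum [LHS]big_mkcond [RHS]big_mkcond /=.
  by apply: eq_bigr => i _; rewrite mxE inE; case: (i \in B); case: (P i).
have cB : #|B| = (#|B :&: initial_segment s n| + #|[set i in B | s <= i]%SET|)%N.
  rewrite -(cardsID (initial_segment s n) B); congr (_ + _)%N.
  by apply: eq_card => i; rewrite !inE -leqNgt andbC.
have sumT : \sum_i indicator_vec R B 0 i = #|B|%:R.
  by rewrite sumB; congr (_%:R); apply: eq_card => i; rewrite inE andbT.
rewrite inE; split => [/andP[/eqP c h]|[_ c h]].
  split; first by move=> i; rewrite mxE; case: (i \in B); rewrite ?lexx ?ler01.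
    by rewrite sumT c.
  by rewrite sumB (ler_nat _ _ 1); lia.
move: c h; rewrite sumT sumB (ler_nat _ _ 1) => /eqP; rewrite eqr_nat => /eqP c.
by move=> h; rewrite c eqxx; rewrite c in cB; lia.
Qed.

Lemma base_polytope_ineqs (x : 'rV[R]_n) : polytope x -> panhandle_ineqs x.
Proof.
move=> [k [c [p [c0 c1 pP ->]]]].
have {}pP j : panhandle_ineqs (p j).
  by have [B /= BP <-] := pP j; apply/panhandle_ineqs_basis.
have E i : (\sum_j c j *: p j) 0 i = \sum_j c j * p j 0 i.
  by rewrite summxE; apply: eq_bigr => j _; rewrite mxE.
have sumE (P : pred 'I_n) : \sum_(i | P i) (\sum_j c j *: p j) 0 i =
    \sum_j c j * \sum_(i | P i) p j 0 i.
  under eq_bigr => i _ do rewrite E.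
  by rewrite exchange_big; apply: eq_bigr => j _; rewrite mulr_sumr.
split.
- move=> i; rewrite E; apply/andP; split.
    by apply: sumr_ge0 => j _; have [/(_ i)/andP[h _] _ _] := pP j; exact: mulr_ge0.
  rewrite -c1; apply: ler_sum => j _; have [/(_ i)/andP[_ h] _ _] := pP j.
  by rewrite ler_piMr.
- rewrite sumE; transitivity (\sum_j c j * r%:R); last by rewrite -mulr_suml c1 mul1r.
  by apply: eq_bigr => j _; have [_ -> _] := pP j.
- rewrite sumE -c1; apply: ler_sum => j _; have [_ _ h] := pP j.
  by rewrite ler_piMr.
Qed.

Lemma convex_hull_convex (m : nat) (A : set 'rV[R]_m) (x y : 'rV[R]_m) (t : R) :
  0 <= t <= 1 -> convex_hull A x -> convex_hull A y ->
  convex_hull A (t *: x + (1 - t) *: y).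
Proof.
move=> /andP[t0 t1] [k [c [p [c0 c1 pA ->]]]] [l [d [q [d0 d1 qA ->]]]].
exists (k + l)%N.
exists (fun i => match fintype.split i with inl j => t * c j | inr j => (1 - t) * d j end).
exists (fun i => match fintype.split i with inl j => p j | inr j => q j end).
split.
- by move=> i; case: fintype.splitP => j _; rewrite mulr_ge0 ?subr_ge0.
- rewrite big_split_ord /=; transitivity (t + (1 - t)); last by rewrite addrC subrK.
  congr (_ + _).
    transitivity (\sum_i t * c i); last by rewrite -mulr_sumr c1 mulr1.
    apply: eq_bigr => i _.
    by case: fintype.splitP => j /= e; [congr (t * c _)|have := ltn_ord i]; [exact: val_inj|lia].
  transitivity (\sum_i (1 - t) * d i); last by rewrite -mulr_sumr d1 mulr1.
  apply: eq_bigr => i _; case: fintype.splitP => j /= e; first by have := ltn_ord j; lia.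
  by congr ((1 - t) * d _); apply: val_inj => /=; lia.
- by move=> i; case: fintype.splitP.
- rewrite big_split_ord /=; congr (_ + _).
    rewrite scaler_sumr; apply: eq_bigr => i _; rewrite scalerA.
    case: fintype.splitP => j /= e; last by have := ltn_ord i; lia.
    by congr ((t * c _) *: p _); exact: val_inj.
  rewrite scaler_sumr; apply: eq_bigr => i _; rewrite scalerA.
  case: fintype.splitP => j /= e; first by have := ltn_ord j; lia.
  by congr (((1 - t) * d _) *: q _); apply: val_inj => /=; lia.
Qed.

Definition fractional (x : 'rV[R]_n) : {set 'I_n} := [set i | 0 < x 0 i < 1]%SET.

Lemma fractional_indicator (x : 'rV[R]_n) :
  panhandle_ineqs x -> fractional x = finset.set0 -> polytope x.
Proof.
move=> xQ fx0; pose B := [set i | x 0 i == 1]%SET.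
have xB : indicator_vec R B = x.
  apply/rowP => i; rewrite mxE inE; have [xi|xi] := eqVneq (x 0 i) 1; first by rewrite xi.
  have : i \notin fractional x by rewrite fx0 inE.
  have [/(_ i)/andP[h0 h1] _ _] := xQ.
  by rewrite inE [_ < 1]lt_neqAle xi h1 !andbT -leNgt => h; apply/le_anti/andP.
exists 1%N, (fun=> 1), (fun=> x); split => //; rewrite ?big_ord1 ?scale1r //.
by move=> _; exists B => //=; apply/panhandle_ineqs_basis; rewrite xB.
Qed.

(* Mass is moved from j to i until one of the two coordinates becomes integral. *)
Lemma fractional_exchange (x : 'rV[R]_n) (i j : 'I_n) :
  panhandle_ineqs x -> i \in fractional x -> j \in fractional x -> i != j ->
  [\/ (s <= i)%N = (s <= j)%N, (i < s <= j)%N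
    | (j < s <= i)%N /\ \sum_(l < n | (s <= l)%N) x 0 l = x 0 i] ->
  exists y, panhandle_ineqs y /\ fractional y \proper fractional x /\
    exists a : R, 0 < a /\ y = x + a *: (delta_mx 0 i - delta_mx 0 j).
Proof.
move=> [x01 xr xs]; rewrite !inE => /andP[xi0 xi1] /andP[xj0 xj1] ij cases.
pose a := Num.min (1 - x 0 i) (x 0 j).
have a0 : 0 < a by rewrite lt_min subr_gt0 xi1.
have ai : a <= 1 - x 0 i by rewrite ge_min lexx.
have aj : a <= x 0 j by rewrite ge_min lexx orbT.
pose y := x + a *: (delta_mx 0 i - delta_mx 0 j).
have yE l : y 0 l = x 0 l + a * ((l == i)%:R - (l == j)%:R) by rewrite !mxE eqxx.
have sum_delta (P : pred 'I_n) l : \sum_(k | P k) (k == l)%:R = (P l)%:R :> R.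
  rewrite big_mkcond (bigD1 l) //= eqxx big1 ?addr0; first by case: (P l).
  by move=> k /negPf ->; case: (P k).
have sumE (P : pred 'I_n) :
    \sum_(l | P l) y 0 l = \sum_(l | P l) x 0 l + a * ((P i)%:R - (P j)%:R).
  under eq_bigr => l _ do rewrite yE.
  by rewrite big_split /= -mulr_sumr sumrB !sum_delta.
exists y; split; last split; last by exists a.
- split.
  + move=> l; rewrite yE; have /andP[l0 l1] := x01 l.
    case: (eqVneq l i) => [->|li]; first by rewrite (negPf ij) subr0 mulr1; lra.
    case: (eqVneq l j) => [->|lj]; first by rewrite sub0r mulrN1; lra.
    by rewrite subrr mulr0; lra.
  + by rewrite sumE xr /= subrr mulr0 addr0.
  (* Only a move from [s] into its complement raises the bounded sum; there that sum is x_i alone,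
     and x_i + a is at most 1. *)
  + rewrite sumE; case: cases => [->|/andP[is_ sj]|[/andP[js si] ->]].
    * by rewrite subrr mulr0 addr0.
    * by rewrite sj leqNgt is_ /=; lra.
    * by rewrite si leqNgt js /=; lra.
- apply/properP; split.
    apply/fintype.subsetP => l; rewrite !inE yE.
    case: (eqVneq l i) => [->|li]; first by rewrite xi0 xi1.
    case: (eqVneq l j) => [->|lj]; first by rewrite xj0 xj1.
    by rewrite subrr mulr0 addr0.
  have [e|e] : a = 1 - x 0 i \/ a = x 0 j.
  + by rewrite /a; case: (leP (1 - x 0 i) (x 0 j)) => _; [left|right].
  + exists i; rewrite !inE ?xi0 ?xi1 // yE eqxx (negPf ij) e.
    by apply/negP => /andP[_]; rewrite subr0 mulr1 subrKC ltxx.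
  + exists j; rewrite !inE ?xj0 ?xj1 // yE eqxx eq_sym (negPf ij) e.
    by rewrite sub0r mulrN1 subrr ltxx.
Qed.

(** When mass can be moved between i and j in both directions, x lies on the segment joining the two
    results, each having fewer fractional coordinates. *)
Lemma fractional_interpolate (x : 'rV[R]_n) (i j : 'I_n) :
  (forall y, panhandle_ineqs y -> fractional y \proper fractional x -> polytope y) ->
  panhandle_ineqs x -> i \in fractional x -> j \in fractional x -> i != j ->
  ((s <= i)%N = (s <= j)%N \/
    (i < s <= j)%N /\ \sum_(l < n | (s <= l)%N) x 0 l = x 0 j) -> polytope x.
Proof.
move=> IH xQ ix jx ij cases.
have [y [yQ [yx [a [a0 ye]]]]] : exists y, panhandle_ineqs y /\
    fractional y \proper fractional x /\
    exists a : R, 0 < a /\ y = x + a *: (delta_mx 0 i - delta_mx 0 j).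
  apply: fractional_exchange => //.
  by case: cases => [e|[e _]]; [constructor 1|constructor 2].
have [z [zQ [zx [b [b0 ze]]]]] : exists y, panhandle_ineqs y /\
    fractional y \proper fractional x /\
    exists a : R, 0 < a /\ y = x + a *: (delta_mx 0 j - delta_mx 0 i).
  apply: fractional_exchange => //; first by rewrite eq_sym.
  by case: cases => [e|e]; [constructor 1|constructor 3].
have ab0 : 0 < a + b by rewrite addr_gt0.
have -> : x = (b / (a + b)) *: y + (1 - b / (a + b)) *: z.
  by rewrite ye ze; apply/rowP => l; rewrite !mxE; field; rewrite gt_eqF.
apply: convex_hull_convex; [|exact: IH|exact: IH].
by rewrite divr_ge0 ?(ltW b0) ?(ltW ab0) //= ler_pdivrMr // mul1r lerDr ltW.
Qed.

(** Induction on the number of fractional coordinates: the task is to find a pair of them between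
    which mass can be moved both ways. *)
Lemma ineqs_base_polytope (x : 'rV[R]_n) : panhandle_ineqs x -> polytope x.
Proof.
have [m] := ubnP #|fractional x|; elim: m x => // m IHm x; rewrite ltnS => xm xQ.
have IH y : panhandle_ineqs y -> fractional y \proper fractional x -> polytope y.
  by move=> yQ yx; apply: IHm => //; exact: leq_trans (proper_card yx) xm.
have interp := fractional_interpolate IH xQ.
have [fx0|[i ix]] := set_0Vmem (fractional x); first exact: fractional_indicator.
have [x01 xr xs] := xQ.
have notfrac l : l \notin fractional x -> x 0 l = 0 \/ x 0 l = 1.
  have /andP[l0 l1] := x01 l.
  by rewrite inE negb_and -!leNgt => /orP[h|h]; [left|right]; apply/le_anti/andP.
(* A single fractional coordinate is impossible, because the coordinate sum is an integer. *)
have [j jx ij] : exists2 j, j \in fractional x & i != j.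
  apply/exists_inP; apply: contraT; rewrite negb_exists_in => /forall_inP h.
  have xi : x 0 i \is a Num.int.
    have -> : x 0 i = r%:R - \sum_(l | l != i) x 0 l.
      by rewrite -xr (bigD1 i) //= addrK.
    rewrite rpredB ?rpred_nat // rpred_sum // => l li.
    have [|->|->] := notfrac l; rewrite ?rpred0 ?rpred1 //.
    by apply/negP => /h; rewrite negbK eq_sym (negPf li).
  move: ix xi; rewrite inE => /andP[xi0 xi1] /intrP[z xz].
  by move: xi0 xi1; rewrite xz (ltr_int _ 0) (ltr_int _ _ 1); lia.
wlog isj : i j ix jx ij / (s <= i)%N = (s <= j)%N \/ (i < s <= j)%N.
  move=> h; have [e|ne] := eqVneq (s <= i)%N (s <= j)%N; first by apply: (h i j); last left.
  have [js|sj] := ltnP j s.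
    apply: (h j i) => //; first by rewrite eq_sym.
    by right; rewrite js; move: ne; lia.
  by apply: (h i j) => //; right; move: ne; lia.
case: isj => [e|/andP[is_ sj]]; first by apply: (interp i j); last left.
have [/existsP[l /and3P[sl lj lx]]|/existsPn h] :=
    boolP [exists l : 'I_n, [&& (s <= l)%N, l != j & l \in fractional x]].
  by apply: (interp l j) => //; left; rewrite sl sj.
apply: (interp i j) => //; right; split; first by rewrite is_.
(* Now j is the only fractional coordinate outside [s]. Another coordinate equal to 1 there would,
   together with x_j > 0, exceed the bound 1; so the others vanish. *)
rewrite (bigD1 j) //= big1 ?addr0 // => l /andP[sl lj].
have /notfrac[//|l1] : l \notin fractional x by have := h l; rewrite sl lj.
move: xs; rewrite (bigD1 j) //= (bigD1 l) /= ?sl ?lj // l1 => xs.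
have : 0 <= \sum_(k < n | (s <= k)%N && (k != j) && (k != l)) x 0 k.
  by apply: sumr_ge0 => k _; have /andP[] := x01 k.
by move: jx; rewrite inE => /andP[xj0 _]; lra.
Qed.

Lemma base_polytopeE : polytope = [set x | panhandle_ineqs x]%classic.
Proof.
by apply/seteqP; split => x; [exact: base_polytope_ineqs|exact: ineqs_base_polytope].
Qed.

End PanhandlePolytope.

(** * Dilations and the affine span *)

Section Dilations.
Variables (R : realType) (r s n : nat).

Definition dilated_ineqs (k : R) (x : 'rV[R]_n) : Prop :=
  [/\ forall i, 0 <= x 0 i <= k, \sum_i x 0 i = r%:R * k
    & \sum_(i < n | (s <= i)%N) x 0 i <= k].

Definition strict_dilated_ineqs (k : R) (x : 'rV[R]_n) : Prop :=
  [/\ forall i, 0 < x 0 i < k, \sum_i x 0 i = r%:R * k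
    & \sum_(i < n | (s <= i)%N) x 0 i < k].

Lemma strict_dilated_ineqsW (k : R) (x : 'rV[R]_n) :
  strict_dilated_ineqs k x -> dilated_ineqs k x.
Proof.
by case=> h1 h2 h3; split => //; [move=> i; have /andP[/ltW -> /ltW ->] := h1 i|exact: ltW].
Qed.

Lemma dilated_ineqsZ (k : R) (x : 'rV[R]_n) : 0 < k ->
  dilated_ineqs k (k *: x) <-> panhandle_ineqs r s x.
Proof.
move=> k0; have sumE (P : pred 'I_n) : \sum_(i | P i) (k *: x) 0 i = k * \sum_(i | P i) x 0 i.
  by rewrite mulr_sumr; apply: eq_bigr => i _; rewrite mxE.
split=> -[h1 h2 h3]; split.
- by move=> i; have := h1 i; rewrite mxE pmulr_rge0 // -[X in _ && (_ <= X)]mulr1 ler_pM2l.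
- by apply: (mulfI (lt0r_neq0 k0)); rewrite -(sumE predT) h2 mulrC.
- by move: h3; rewrite sumE -[X in _ <= X]mulr1 ler_pM2l.
- by move=> i; rewrite mxE pmulr_rge0 // -[X in _ && (_ <= X)]mulr1 ler_pM2l.
- by rewrite sumE h2 mulrC.
- by rewrite sumE -[X in _ <= X]mulr1 ler_pM2l.
Qed.

(* Integer coordinates of [interior_scale] times an interior point of the
   polytope, whose coordinates sum to 1/2 outside [s]. *)
Definition interior_weight (i : 'I_n) : nat :=
  if (i < s)%N then ((2 * r - 1) * (n - s))%N else s.

Definition interior_scale : nat := (2 * s * (n - s))%N.

Hypotheses (r_gt0 : (0 < r)%N) (rs : (r <= s)%N) (sn : (s < n)%N).

Let sum_head (c : nat) : (\sum_(i < n | i < s) c = s * c)%N.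
Proof. by rewrite -(big_ord_widen n (fun=> c) (ltnW sn)) sum_nat_const card_ord. Qed.

Let sum_tail (c : nat) : (\sum_(i < n | s <= i) c = (n - s) * c)%N.
Proof.
apply: (@addnI (s * c)%N); rewrite -mulnDl subnKC 1?ltnW // -{1}sum_head.
transitivity (\sum_(i < n) c)%N; last by rewrite sum_nat_const card_ord.
rewrite [RHS](bigID (fun i : 'I_n => (i < s)%N)) /=; congr (_ + _)%N.
by apply: eq_bigl => i; rewrite -leqNgt.
Qed.

Lemma tail_interior_weight :
  (\sum_(i < n | s <= i) interior_weight i = (n - s) * s)%N.
Proof.
rewrite -sum_tail; apply: eq_bigr => i; rewrite /interior_weight leqNgt.
by move=> /negPf ->.
Qed.

Lemma sum_interior_weight : (\sum_i interior_weight i = r * interior_scale)%N.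
Proof.
rewrite (bigID (fun i : 'I_n => (s <= i)%N)) /= tail_interior_weight.
rewrite (eq_bigl (fun i : 'I_n => (i < s)%N)); last by move=> i; rewrite -ltnNge.
rewrite (eq_bigr (fun=> (2 * r - 1) * (n - s))%N); last first.
  by move=> i; rewrite /interior_weight => ->.
rewrite sum_head /interior_scale; move: (n - s)%N => m.
have {2}-> : r = (r - 1 + 1)%N by lia.
have -> : (2 * r - 1 = 2 * (r - 1) + 1)%N by lia.
by move: (r - 1)%N => q; ring.
Qed.

Lemma interior_weight_bounds i :
  (0 < interior_weight i)%N /\ (interior_weight i < interior_scale)%N.
Proof. by rewrite /interior_weight /interior_scale; case: ifP => _; split; nia. Qed.

Lemma tail_lt_interior_scale : ((n - s) * s < interior_scale)%N.
Proof. by rewrite /interior_scale; nia. Qed.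

Definition interior_row : 'rV[R]_n := \row_i (interior_weight i)%:R.

(** The interior point has integer coordinates, so it satisfies each strict inequality with slack at
    least 1. Adding C times it creates slack C, which absorbs a perturbation [u] of l1 norm below
    C. *)
Lemma dilated_ineqs_shift (k C : R) (x u : 'rV[R]_n) :
  dilated_ineqs k x -> \sum_i u 0 i = 0 -> \sum_i `|u 0 i| < C ->
  strict_dilated_ineqs (k + C * interior_scale%:R) (x + u + C *: interior_row).
Proof.
move=> [h1 h2 h3] u0 uC.
have C0 : 0 < C by apply: le_lt_trans uC; apply: sumr_ge0.
have sumE (P : pred 'I_n) : \sum_(i | P i) (x + u + C *: interior_row) 0 i =
    \sum_(i | P i) x 0 i + \sum_(i | P i) u 0 i + C * (\sum_(i | P i) interior_weight i)%:R.
  rewrite natr_sum mulr_sumr -!big_split; apply: eq_bigr => i _.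
  by rewrite !mxE.
have le_sum (P : pred 'I_n) : `|\sum_(i | P i) u 0 i| <= \sum_i `|u 0 i|.
  apply: (le_trans (ler_norm_sum _ _ _)).
  by rewrite [leLHS]big_mkcond; apply: ler_sum => i _; case: ifP.
split.
- move=> i; have [w0 w1] := interior_weight_bounds i; have /andP[x0 x1] := h1 i.
  have := le_sum (pred1 i); rewrite big_pred1_eq => /le_lt_trans/(_ uC).
  rewrite ltr_norml !mxE => /andP[u1 u2].
  have a1 : C * 1 <= C * (interior_weight i)%:R by rewrite ler_pM2l // ler1n.
  have a2 : C * ((interior_weight i)%:R + 1) <= C * interior_scale%:R.
    by rewrite ler_pM2l // natr1 ler_nat.
  by apply/andP; split; lra.
- by rewrite sumE h2 u0 sum_interior_weight natrM; ring.
- rewrite sumE tail_interior_weight.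
  have := le_sum (fun i => s <= i)%N => /le_lt_trans/(_ uC).
  rewrite ltr_norml => /andP[u1 u2].
  have a2 : C * (((n - s) * s)%:R + 1) <= C * interior_scale%:R.
    by rewrite ler_pM2l // natr1 ler_nat tail_lt_interior_scale.
  by lra.
Qed.

Lemma affine_span_panhandle (rs' : (r <= s)%N) (sn' : (s < n)%N) :
  affine_span (base_polytope R (panhandle rs' sn')) =
  [set x | \sum_i x 0 i = r%:R]%classic.
Proof.
rewrite base_polytopeE; apply/seteqP; split => x /=.
  move=> [k [c [p [c1 pP ->]]]].
  under eq_bigr => i _ do rewrite summxE.
  rewrite exchange_big.
  transitivity (\sum_j c j * r%:R); last by rewrite -mulr_suml c1 mul1r.
  apply: eq_bigr => j _; have [_ <- _] := pP j; rewrite mulr_sumr.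
  by apply: eq_bigr => i _; rewrite mxE.
move=> xr; pose D : R := interior_scale%:R.
have D0 : 0 < D.
  by rewrite ltr0n; have [] := interior_weight_bounds (Ordinal sn); lia.
pose x0 := D^-1 *: interior_row.
have x0r : \sum_i x0 0 i = r%:R.
  rewrite /x0; under eq_bigr => i _ do rewrite !mxE.
  rewrite -mulr_sumr -natr_sum sum_interior_weight natrM mulrCA mulVf ?mulr1 //.
  exact: lt0r_neq0.
pose C : R := \sum_i `|(x - x0) 0 i| + 1.
have C0 : 0 < C by rewrite ltr_wpDl // sumr_ge0.
have CD0 : 0 < C * D by rewrite mulr_gt0.
(* This is [dilated_ineqs_shift] at the origin of the dilation by 0, rescaled by C D. It places a
   small multiple of x - x0 inside the polytope, and x lies on the line through that point and
   x0. *)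
have inQ (u : 'rV[R]_n) : \sum_i u 0 i = 0 -> \sum_i `|u 0 i| < C ->
    panhandle_ineqs r s (x0 + (C * D)^-1 *: u).
  move=> u0 uC; apply/(dilated_ineqsZ _ CD0).
  have z0 : dilated_ineqs 0 (0 : 'rV[R]_n).
    by split; rewrite ?mulr0 ?big1 // => i *; rewrite mxE ?lexx.
  have := strict_dilated_ineqsW (dilated_ineqs_shift z0 u0 uC).
  rewrite !add0r (_ : _ *: (x0 + _) = u + C *: interior_row) //.
  by apply/rowP => i; rewrite !mxE; field; rewrite !lt0r_neq0.
have xx0 : \sum_i (x - x0) 0 i = 0.
  transitivity (\sum_i x 0 i - \sum_i x0 0 i); last by rewrite xr x0r subrr.
  by rewrite -sumrB; apply: eq_bigr => i _; rewrite !mxE.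
have yQ : panhandle_ineqs r s (x0 + (C * D)^-1 *: (x - x0)).
  by apply: inQ => //; rewrite ltrDl.
have x0Q : panhandle_ineqs r s x0.
  have := inQ 0; rewrite scaler0 addr0; apply.
    by rewrite big1 // => i _; rewrite mxE.
  by rewrite big1 // => i _; rewrite mxE normr0.
exists 2%N, (fun i : 'I_2 => if i == 0 then C * D else 1 - C * D).
exists (fun i : 'I_2 => if i == 0 then x0 + (C * D)^-1 *: (x - x0) else x0).
split.
- by rewrite !big_ord_recl big_ord0 /= addr0 addrC subrK.
- by move=> i; case: ifP.
- rewrite !big_ord_recl big_ord0 /=; apply/rowP => i; rewrite !mxE; field.
  by rewrite !lt0r_neq0.
Qed.

End Dilations.

(** * Volume in a chart *)

Section LatticeRows.
Variables (R : realType) (r s N : nat).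
Hypothesis sN : (s <= N)%N.

Definition lattice_row (k : nat) (a : {ffun 'I_N.+1 -> 'I_k}) : 'rV[R]_N.+1 :=
  \row_i (a (rev_ord i))%:R.

Lemma lattice_rowP (k : nat) (a : {ffun 'I_N.+1 -> 'I_k}) :
  (a \in reversed_lattice_points r s N k) <->
  strict_dilated_ineqs r s k%:R (lattice_row a).
Proof.
have sumE (P : pred 'I_N.+1) : \sum_(i | P i) lattice_row a 0 i =
    (\sum_(i | P (rev_ord i)) a i)%:R.
  rewrite natr_sum (reindex_inj rev_ord_inj) /=; apply: eq_bigr => i _.
  by rewrite mxE rev_ordK.
have tailE : (\sum_(i < N.+1 | s <= rev_ord i) a i = \sum_(i < N.+1 | i < N.+1 - s) a i)%N.
  by apply: eq_bigl => i /=; have := ltn_ord i; lia.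
rewrite inE; split=> [/and3P[/forallP a0 /eqP sa ta]|[h1 h2 h3]].
  split; first by move=> i; rewrite mxE ltr0n ltr_nat a0 ltn_ord.
    by rewrite sumE /= sa natrM.
  by rewrite sumE ltr_nat tailE.
apply/and3P; split.
- by apply/forallP => i; have := h1 (rev_ord i); rewrite mxE rev_ordK ltr0n => /andP[].
- by apply/eqP; move: h2; rewrite sumE -natrM => /eqP; rewrite eqr_nat => /eqP.
- by move: h3; rewrite sumE ltr_nat tailE.
Qed.

Lemma lattice_row_surj (k : nat) (y : 'rV[R]_N.+1) : y \is a mxOver Num.int ->
  strict_dilated_ineqs r s k%:R y ->
  exists2 a : {ffun 'I_N.+1 -> 'I_k},
    a \in reversed_lattice_points r s N k & lattice_row a = y.
Proof.
move=> /mxOverP yint yk; have [y01 _ _] := yk.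
have ynat i : {m : 'I_k | y 0 i = (val m)%:R}.
  apply: cid; have /intrP[z yz] := yint 0 i; have := y01 i; rewrite yz.
  rewrite (ltr_int _ 0) -[k%:R]/(k%:Z%:~R) ltr_int => /andP[z0 zk].
  have mk : (`|z| < k)%N by lia.
  by exists (Ordinal mk); rewrite /= natr_absz gtr0_norm.
pose a := [ffun i => sval (ynat (rev_ord i))].
have ay : lattice_row a = y.
  by apply/rowP => i; rewrite mxE ffunE rev_ordK -(svalP (ynat i)).
by exists a => //; apply/lattice_rowP; rewrite ay.
Qed.

Lemma lattice_row_inj (k : nat) : injective (@lattice_row k).
Proof.
move=> a b /rowP e; apply/ffunP => i; apply: val_inj; apply/eqP.
by have /eqP := e (rev_ord i); rewrite !mxE rev_ordK eqr_nat.
Qed.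

End LatticeRows.

Section Charts.
Variables (R : realType) (r s N : nat).
Hypotheses (r_gt0 : (0 < r)%N) (rs : (r <= s)%N) (sn : (s < N.+1)%N).

Local Notation polytope := (base_polytope R (panhandle rs sn)).

Let chart_sum (d : nat) (p : 'rV[R]_N.+1) (B : 'M[R]_(d, N.+1)) (v : 'rV[R]_d) :
  lattice_chart polytope p B -> \sum_i (p + v *m B) 0 i = r%:R.
Proof.
case=> _ img _; have : affine_span polytope (p + v *m B) by rewrite -img; exists v.
by rewrite affine_span_panhandle.
Qed.

Let chart_sum0 (d : nat) (p : 'rV[R]_N.+1) (B : 'M[R]_(d, N.+1)) (v : 'rV[R]_d) :
  lattice_chart polytope p B -> \sum_i (v *m B) 0 i = 0.
Proof.
move=> ch; have := chart_sum v ch; rewrite -(chart_sum 0 ch) mul0mx addr0.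
under eq_bigr => i _ do rewrite mxE.
by rewrite big_split /= -[RHS]addr0 => /addrI.
Qed.

Let chart_surj (d : nat) (p : 'rV[R]_N.+1) (B : 'M[R]_(d, N.+1)) (x : 'rV[R]_N.+1) :
  lattice_chart polytope p B -> \sum_i x 0 i = r%:R -> exists v, x = p + v *m B.
Proof.
case=> _ img _ xr; have : affine_span polytope x by rewrite affine_span_panhandle.
by rewrite -img => -[v _ <-]; exists v.
Qed.

(** The row space of [B] is the direction of the affine span, the kernel of the coordinate sum,
    which has dimension N. *)
Lemma chart_dim (d : nat) (p : 'rV[R]_N.+1) (B : 'M[R]_(d, N.+1)) :
  lattice_chart polytope p B -> d = N.
Proof.
move=> ch; have [rB _ _] := ch; move: (rB) => /eqP <-.
pose one : 'cV[R]_N.+1 := const_mx 1.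
have mul1 (u : 'rV[R]_N.+1) : u *m one = (\sum_i u 0 i)%:M.
  apply/rowP => j; rewrite !mxE ord1 eqxx mulr1n; apply: eq_bigr => i _.
  by rewrite mxE mulr1.
have -> : \rank B = \rank (kermx one).
  apply/eqP; rewrite eqn_leq !mxrankS //.
    apply/rV_subP => u; rewrite sub_kermx mul1 => /eqP u0.
    have [v] : exists v, p + u = p + v *m B.
      apply: (chart_surj ch); have := chart_sum 0 ch; rewrite mul0mx addr0 => <-.
      under eq_bigr => i _ do rewrite mxE.
      rewrite big_split /= (_ : \sum_i u 0 i = 0) ?addr0 //.
      by have /rowP/(_ 0) := u0; rewrite !mxE eqxx mulr1n.
    by move/addrI => ->; exact: submxMl.
  apply/rV_subP => _ /submxP[v ->]; rewrite sub_kermx mul1 (chart_sum0 v ch).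
  by rewrite raddf0.
rewrite mxrank_ker; have -> : \rank one = 1%N; last by rewrite subn1.
apply/eqP; rewrite eqn_leq rank_leq_col lt0n mxrank_eq0.
by apply/eqP => /colP/(_ 0)/eqP; rewrite !mxE oner_eq0.
Qed.

(* The lattice basis e_i - e_N of the hyperplane of coordinate sum 0, based at
   r e_N. *)
Lemma chart_exists : exists (p : 'rV[R]_N.+1) (B : 'M[R]_(N, N.+1)),
  lattice_chart polytope p B.
Proof.
pose B : 'M[R]_(N, N.+1) :=
  \matrix_(i, j) ((j == lift ord_max i)%:R - (j == ord_max)%:R).
pose p : 'rV[R]_N.+1 := r%:R *: delta_mx 0 ord_max.
have vBl (v : 'rV[R]_N) i : (p + v *m B) 0 (lift ord_max i) = v 0 i.
  rewrite !mxE eqxx [lift _ _ == _]eq_sym (negPf (neq_lift _ _)) mulr0 add0r.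
  rewrite (bigD1 i) //= mxE eqxx [lift _ _ == _]eq_sym (negPf (neq_lift _ _)).
  rewrite subr0 mulr1 big1 ?addr0 // => j ji.
  rewrite mxE [lift _ _ == ord_max]eq_sym (negPf (neq_lift _ _)).
  by rewrite (inj_eq lift_inj) eq_sym (negPf ji) subrr mulr0.
have vBm (v : 'rV[R]_N) : (p + v *m B) 0 ord_max = r%:R - \sum_i v 0 i.
  rewrite !mxE !eqxx mulr1; congr (_ + _); rewrite -sumrN; apply: eq_bigr => i _.
  by rewrite mxE eqxx (negPf (neq_lift _ _)) sub0r mulrN1.
have sumL (x : 'rV[R]_N.+1) :
    \sum_i x 0 i = x 0 ord_max + \sum_i x 0 (lift ord_max i).
  by rewrite (bigD1_ord ord_max).
exists p, B; split.
- apply: inj_row_free => v vB0; apply/rowP => i.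
  by rewrite -vBl vB0 addr0 !mxE eqxx [lift _ _ == _]eq_sym (negPf (neq_lift _ _)) mulr0.
- rewrite affine_span_panhandle //; apply/seteqP; split => x /=.
    move=> [v _ <-]; rewrite sumL.
    transitivity (r%:R - \sum_i v 0 i + \sum_i v 0 i); last exact: subrK.
    by rewrite -vBm; congr (_ + _); apply: eq_bigr => i _; exact: vBl.
  move=> xr; exists (\row_i x 0 (lift ord_max i)) => //; apply/rowP => j.
  case: (unliftP ord_max j) => [i|] ->; first by rewrite vBl mxE.
  rewrite vBm -xr sumL; transitivity (x 0 ord_max + \sum_i x 0 (lift ord_max i) -
      \sum_i x 0 (lift ord_max i)); last exact: addrK.
  by congr (_ - _); apply: eq_bigr => i _; rewrite mxE.
- move=> v; apply/mxOverP/mxOverP => h i j.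
    by rewrite ord1 -vBl.
  rewrite ord1; case: (unliftP ord_max j) => [l|] ->; first by rewrite vBl.
  by rewrite vBm rpredB ?rpred_nat ?rpred_sum.
Qed.

Section Sandwich.
Variables (p : 'rV[R]_N.+1) (B : 'M[R]_(N, N.+1)).
Hypothesis ch : lattice_chart polytope p B.

(** Bounds the l1 norm of the image under [B] of any vector with entries in [0, 1). Adding [C] times
    the interior point thus absorbs the passage from a point of a cube to its corner, and enlarges
    the dilation factor by [D]. *)
Let total : R := \sum_i \sum_j `|B j i|.
Let C : nat := (Num.trunc total).+1.
Let D : nat := (C * interior_scale s N.+1)%N.

Let total_lt : total < C%:R.
Proof. exact: truncnS_gt. Qed.

(* The offset of k v from the lower corner of its integer unit cube. *)
Let frac (k : R) (v : 'rV[R]_N) : 'rV[R]_N :=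
  k *: v - map_mx intr (map_mx (fun x => Num.floor (k * x)) v).

Let frac_bound k v : \sum_i `|(frac k v *m B) 0 i| < C%:R /\
  \sum_i `|(- frac k v *m B) 0 i| < C%:R.
Proof.
have h : \sum_i `|(frac k v *m B) 0 i| < C%:R.
  apply: le_lt_trans total_lt; apply: ler_sum => i _; rewrite mxE.
  apply: (le_trans (ler_norm_sum _ _ _)); apply: ler_sum => j _.
  rewrite normrM ler_piMl // !mxE ler_norml.
  by have := floor_itv (k * v 0 j); rewrite intrD => /andP[h1 h2]; apply/andP; split; lra.
split=> //; under eq_bigr => i _ do rewrite mulNmx mxE normrN.
exact: h.
Qed.

Let p_int : p \is a mxOver Num.int.
Proof.
have [_ _ /(_ 0)] := ch; rewrite mul0mx addr0 => ->.
by apply/mxOverP => i j; rewrite mxE rpred0.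
Qed.

Let volume := lebesgue_rV [set v | polytope (p + v *m B)]%classic.

Let int_rowK (z : 'rV[int]_N) : map_mx Num.floor (map_mx intr z : 'rV[R]_N) = z.
Proof. by apply/rowP => i; rewrite !mxE intrKfloor. Qed.

Lemma volume_le_lattice (k : nat) :
  (volume <= (#|reversed_lattice_points r s N (k.+1 + D)|%:R / k.+1%:R ^+ N)%:E)%E.
Proof.
(* Each lattice point is carried back to the cube corner it came from: undo the shift by the
   interior point, then invert the chart. *)
pose F := [seq map_mx Num.floor ((@lattice_row R N _ a - k.+1%:R *: p -
    C%:R *: interior_row R r s N.+1) *m pinvmx B)
  | a in reversed_lattice_points r s N (k.+1 + D)].
have h : ([set v | polytope (p + v *m B)] `<=` @grid_cubes R N k.+1 (undup F))%classic.
  move=> v /= /base_polytope_ineqs vQ; rewrite /grid_cubes /= mem_undup.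
  set K : R := k.+1%:R; set z := map_mx _ v.
  have K0 : 0 < K by rewrite ltr0n.
  have [f1 f2] := frac_bound K v.
  have s0 : \sum_i (- frac K v *m B) 0 i = 0 by exact: chart_sum0 ch.
  have := dilated_ineqs_shift r_gt0 rs sn ((dilated_ineqsZ _ _ _ K0).2 vQ) s0 f2.
  set y := _ + _ + _ => ys.
  have yE : y = K *: p + map_mx intr z *m B + C%:R *: interior_row R r s N.+1.
    rewrite /y /frac -/z mulNmx mulmxBl scalerDr -scalemxAl opprB.
    by congr (_ + _); rewrite -!addrA subrKC.
  have yint : y \is a mxOver Num.int.
    (* The chart gives integrality of p + z B; the remaining multiple k p is integral because p
       is. *)
    rewrite yE; have [_ _ /(_ (map_mx intr z))] := ch.
    have -> : map_mx intr z \is a mxOver (@Num.int R).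
      by apply/mxOverP => i j; rewrite mxE intr_int.
    move=> /mxOverP h; apply/mxOverP => i j; have := h i j; have /mxOverP/(_ i j) := p_int.
    rewrite !mxE => pi pz; rewrite rpredD ?rpredM ?rpred_nat //.
    rewrite -[K]/(k.+1%:R) -natr1 mulrDl mul1r -addrA rpredD ?rpredM ?rpred_nat //.
  have : strict_dilated_ineqs r s (k.+1 + D)%:R y by rewrite natrD natrM.
  move/(lattice_row_surj (ltnSE sn) yint) => [a aL ya].
  apply/fintype.imageP; exists a => //; rewrite ya yE.
  rewrite addrAC addrK addrC addKr mulmxKp // ?int_rowK //.
  by have [] := ch.
apply: (le_trans (le_lebesgue_rV h)); rewrite lebesgue_grid_cubes ?undup_uniq //.
rewrite lee_fin ler_wpM2r ?invr_ge0 ?exprn_ge0 // ler_nat.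
by apply: (leq_trans (size_undup _)); rewrite size_image.
Qed.

Lemma lattice_le_volume (k : nat) :
  ((#|reversed_lattice_points r s N k.+1|%:R / (k + D).+1%:R ^+ N)%:E <= volume)%E.
Proof.
set K : R := (k + D).+1%:R; have K0 : 0 < K by rewrite ltr0n.
have KE : k.+1%:R + C%:R * (interior_scale s N.+1)%:R = K.
  by rewrite -natrM -natrD.
pose f (a : {ffun 'I_N.+1 -> 'I_k.+1}) := map_mx Num.floor
  ((lattice_row R a - K *: p + C%:R *: interior_row R r s N.+1) *m pinvmx B).
have fE a : a \in reversed_lattice_points r s N k.+1 -> map_mx intr (f a) *m B =
    lattice_row R a - K *: p + C%:R *: interior_row R r s N.+1.
  move=> /(lattice_rowP R r (ltnSE sn))/strict_dilated_ineqsW aL.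
  have z0 : \sum_i (0 : 'rV[R]_N.+1) 0 i = 0 by rewrite big1 // => i _; rewrite mxE.
  have zC : \sum_i `|(0 : 'rV[R]_N.+1) 0 i| < C%:R.
    by rewrite big1 ?ltr0n // => i _; rewrite mxE normr0.
  have [_ + _] := dilated_ineqs_shift r_gt0 rs sn aL z0 zC.
  rewrite KE addr0; set y := _ + _ => yr.
  have [v yv] : exists v, K^-1 *: y = p + v *m B.
    apply: (chart_surj ch); under eq_bigr => i _ do rewrite mxE.
    by rewrite -mulr_sumr yr mulrC mulfK ?lt0r_neq0.
  have {}yv : y = K *: p + (K *: v) *m B.
    by rewrite -scalemxAl -scalerDr -yv scalerA mulfV ?lt0r_neq0 // scale1r.
  have -> : lattice_row R a - K *: p + C%:R *: interior_row R r s N.+1 = (K *: v) *m B.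
    by rewrite addrAC -/y yv addrC addKr.
  rewrite /f (_ : _ - _ + _ = (K *: v) *m B); last first.
    by rewrite addrAC -/y yv addrC addKr.
  have [rB _ /(_ (K *: v))] := ch; rewrite mulmxKp // => vint; congr (_ *m _).
  (* The chart condition is used backwards: p + (K v) B equals y - (K - 1) p, which is integral. *)
  have /mxOverP h : K *: v \is a mxOver Num.int.
    rewrite -vint (_ : _ + _ = y - (k + D)%:R *: p).
      apply/mxOverP => i j; rewrite !mxE.
      have /mxOverP/(_ i j) := p_int.
      by move=> pi; rewrite rpredB ?rpredD ?rpredM ?rpred_nat.
    rewrite yv; move: (_ *m B) => w; apply/rowP => j; rewrite !mxE /K -natr1; ring.
  by apply/rowP => i; have := h 0 i; rewrite !mxE => /floorK.
have fL : (@grid_cubes R N (k + D).+1 [seq f a | a in reversed_lattice_points r s N k.+1]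
    `<=` [set v | polytope (p + v *m B)])%classic.
  (* On the whole cube, K (p + v B) is the lattice point plus the image of the offset [frac K v]
     plus [C] times the interior point, so it stays in the dilation by K. *)
  move=> v /fintype.imageP[a aL zE]; apply: ineqs_base_polytope; apply/(dilated_ineqsZ _ _ _ K0).
  have /(lattice_rowP R r (ltnSE sn))/strict_dilated_ineqsW aS := aL.
  have [f1 _] := frac_bound K v.
  have := strict_dilated_ineqsW
    (dilated_ineqs_shift r_gt0 rs sn aS (chart_sum0 (frac K v) ch) f1).
  rewrite KE (_ : _ + _ + _ = K *: (p + v *m B)) //.
  rewrite /frac zE mulmxBl fE // -scalemxAl scalerDr.
  by apply/rowP => i; rewrite !mxE; ring.
have uF : uniq [seq f a | a in reversed_lattice_points r s N k.+1].
  rewrite map_inj_in_uniq ?enum_uniq // => a b; rewrite !mem_enum => aL bL ab.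
  apply: (@lattice_row_inj R); have := fE a aL; rewrite ab (fE b bL).
  by move/addIr/addIr.
have := le_lebesgue_rV fL; rewrite lebesgue_grid_cubes //.
by rewrite size_image.
Qed.

(** Both lattice counts are W k^N / N! up to lower order, so [pow_squeeze] turns the two bounds on
    the volume into an equality. *)
Lemma chart_volume :
  ((N`!%:R)%:E * volume =
   (#|[set w : 'S_N | panhandle_descents r s (Des w)]%SET|%:R)%:E)%E.
Proof.
set W := #|_|.
have upper k : (volume <= ((W * 'C(N + (k + D), N))%:R / k.+1%:R ^+ N)%:E)%E.
  apply: (le_trans (volume_le_lattice k)).
  rewrite lee_fin ler_wpM2r ?invr_ge0 ?exprn_ge0 // ler_nat addSn.
  exact: (lattice_points_le r_gt0 rs (ltnSE sn)).
have lower k : (((W * 'C(k, N))%:R / (k + D).+1%:R ^+ N)%:E <= volume)%E.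
  apply: le_trans (lattice_le_volume k).
  rewrite lee_fin ler_wpM2r ?invr_ge0 ?exprn_ge0 // ler_nat.
  exact: (lattice_points_ge r_gt0 rs (ltnSE sn)).
have v0 : (0 <= volume)%E by exact: lebesgue_rV_ge0.
have vfin : volume \is a fin_num.
  by rewrite ge0_fin_numE // (le_lt_trans (upper 0%N)) // ltry.
move: upper lower v0; rewrite -(fineK vfin); set V := fine volume => upper lower.
rewrite lee_fin => V0; rewrite -EFinM; congr (_%:E); apply/le_anti/andP; split.
  apply: (@pow_squeeze _ _ _ N (N + D)); first by rewrite mulr_ge0.
  move=> k; have := upper k.
  rewrite lee_fin ler_pdivlMr ?exprn_gt0 // => /(ler_wpM2l (ler0n R N`!)) h.
  apply: (le_trans _ (le_trans h _)).
    by rewrite mulrA ler_wpM2l ?mulr_ge0 // lerXn2r ?nnegrE // ler_nat.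
  rewrite -natrM -natrX -natrM ler_nat mulnCA leq_mul2l mulnC bin_ffact.
  by rewrite addnCA ffact_le_exp orbT.
apply: (@pow_squeeze _ _ _ N (N + D).+1) => // k.
(* Evaluating at k + N makes the falling factorial at least (k + 1)^N, hence at least k^N. *)
have := lower (k + N)%N.
rewrite lee_fin ler_pdivrMr ?exprn_gt0 // => /(ler_wpM2l (ler0n R N`!)) h.
rewrite mulrA -addnA -addnS in h; apply: le_trans h.
rewrite -natrM -natrX -natrM ler_nat mulnCA leq_mul2l mulnC bin_ffact addnC.
apply/orP; right; apply: leq_trans (exp_le_ffact _ _).
by have [->|N0] := posnP N; rewrite ?expn0 // leq_exp2r.
Qed.

End Sandwich.
End Charts.

(** * The normalized volume *)

Lemma normalized_volume_charts (R : realType) (n : nat) (P : set 'rV[R]_n) (V : \bar R) :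
  (exists d (p : 'rV[R]_n) (B : 'M[R]_(d, n)), lattice_chart P p B) ->
  (forall d (p : 'rV[R]_n) (B : 'M[R]_(d, n)), lattice_chart P p B ->
     ((d`!%:R)%:E * lebesgue_rV [set v | P (p + v *m B)%R]%classic)%E = V) ->
  normalized_volume P = V.
Proof.
move=> [d [p [B ch]]] vol; apply: xget_subset1.
  by exists d, p, B; rewrite vol.
move=> _ _ [d1 [p1 [B1 [ch1 ->]]]] [d2 [p2 [B2 [ch2 ->]]]].
by rewrite (vol _ _ _ ch1) (vol _ _ _ ch2).
Qed.

(** Serves the case r = 0. The affine span is a point, so a row-free chart matrix has no rows and
    the volume is that of R^0. *)
Lemma normalized_volume_origin (R : realType) (n : nat) :
  normalized_volume [set (0 : 'rV[R]_n)]%classic = 1%E.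
Proof.
have span0 : affine_span [set (0 : 'rV[R]_n)]%classic = [set 0]%classic.
  apply/seteqP; split => x /=.
    by move=> [k [c [p [_ p0 ->]]]]; rewrite big1 // => i _; rewrite [p i]p0 scaler0.
  by move=> ->; exists 1%N, (fun=> 1), (fun=> 0); rewrite !big_ord1 scaler0.
apply: normalized_volume_charts.
  exists 0%N, 0, 0; split.
  - by rewrite /row_free mxrank0.
  - rewrite span0; apply/seteqP; split => x /=.
      by move=> [v _ <-]; rewrite mulmx0 addr0.
    by move=> ->; exists 0 => //; rewrite mulmx0 addr0.
  - move=> v; rewrite mulmx0 addr0; apply/mxOverP/mxOverP => _ i j; first by case: j.
    by rewrite mxE rpred0.
move=> d p B [rB img _].
have pv0 v : p + v *m B = 0.
  suff : [set (0 : 'rV[R]_n)]%classic (p + v *m B) by [].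
  by rewrite -span0 -img; exists v.
have d0 : d = 0%N.
  have B0 : B = 0.
    apply/row_matrixP => i; rewrite row0 rowE; apply: (addrI p).
    by rewrite pv0 -[in RHS](mul0mx _ B) pv0.
  by move/eqP: rB; rewrite B0 mxrank0.
subst d; rewrite /= indicE mem_set ?mul1e //=.
Qed.

Lemma sum_beta (R : comNzRingType) (n : nat) (P : pred {set 'I_n.-1}) :
  \sum_(S | P S) (beta S)%:R = #|[set w : 'S_n.-1 | P (Des w)]%SET|%:R :> R.
Proof.
rewrite -natr_sum; congr (_%:R); rewrite -sum1dep_card (partition_big (@Des n.-1) P) //=.
apply: eq_bigr => S PS; rewrite /beta -sum1dep_card; apply: eq_bigl => w.
by case: eqP => [->|]; rewrite ?PS ?andbF.
Qed.

(** Inclusion-exclusion leaves only the empty T, whose single gap n - 1 gives the multinomial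
    coefficient 1. *)
Lemma beta_set0 (n : nat) : beta (finset.set0 : {set 'I_n.-1}) = 1%N.
Proof.
apply/eqP; rewrite -(eqr_nat rat) beta_inclusion_exclusion.
rewrite (big_pred1 finset.set0); last by move=> T; rewrite finset.subset0.
rewrite finset.setDv cards0 expr0 mul1r /gaps enum_set0 /= subn0.
by rewrite /multinomial big_seq1 divnn fact_gt0.
Qed.

(* In the degenerate case r = 0 the polytope is a point, of normalized volume 1,
   and the truncated subtraction r - 1 = 0 leaves the single summand for the
   empty S, namely 1; read in the integers, |S| = r - 1 would make the right-hand
   side 0 and the identity false. *)
Theorem theorem7p2 (R : realType) (r s n : nat)
    (rs : (r <= s)%N) (sn : (s < n)%N) :
  normalized_volume (base_polytope R (panhandle rs sn)) =
    (\sum_(S : {set 'I_n.-1} |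
        (S \subset int_interval n.-1 (n - s) (n - 2)) && (#|S| == r - 1)%N)
       (beta S)%:R)%:E
  /\
  \sum_(S : {set 'I_n.-1} |
      (S \subset int_interval n.-1 (n - s) (n - 2)) && (#|S| == r - 1)%N)
     (beta S)%:R
  = \sum_(S : {set 'I_n.-1} |
      (S \subset int_interval n.-1 (n - s) (n - 2)) && (#|S| == r - 1)%N)
      \sum_(T : {set 'I_n.-1} | T \subset S)
        (-1) ^+ #|S :\: T| * (multinomial n.-1 (gaps T))%:R :> R.
Proof.
split; last by apply: eq_bigr => S _; exact: beta_inclusion_exclusion.
case: n sn => // N sN; have [r0|r_gt0] := posnP r.
  subst r; rewrite (big_pred1 finset.set0) ?beta_set0; last first.
    move=> S; rewrite cards_eq0 /=; case: eqP => [->|]; rewrite ?andbF ?andbT //.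
    exact: finset.sub0set.
  rewrite -(normalized_volume_origin R N.+1) base_polytopeE; congr normalized_volume.
  apply/seteqP; split => x /=.
    (* For r = 0, nonnegative coordinates with sum 0 all vanish. *)
    move=> [x01 /eqP + _]; rewrite psumr_eq0 => [/allP x0|i _]; last first.
      by have /andP[] := x01 i.
    by apply/rowP => i; rewrite mxE; apply/eqP/x0; rewrite mem_index_enum.
  by move=> ->; split=> [i||]; rewrite ?big1 // => *; rewrite mxE ?lexx ?ler01.
apply: normalized_volume_charts.
  by have [p [B ch]] := chart_exists R r_gt0 rs sN; exists N, p, B.
move=> d p B ch; have dN := chart_dim r_gt0 ch; subst d.
by rewrite (chart_volume r_gt0 ch) sum_beta.
Qed.
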